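(* Let $F=(f,g)\in C^1_H(\mathbb H^1,\mathbb R^2)$ with $F(0)=0$ and $D_hF(0)$ surjective, and suppose that the horizontal derivatives of $f$ satisfy, for all $A,B\in\mathbb H^1$, $$\max\{|Xf(A)-Xf(B)|,\ |Yf(A)-Yf(B)|\}\le m\big(d_\infty(A,B)^2\big),$$ where $m:\mathbb R_+\to\mathbb R_+$ is monotone and $\sum_{k=0}^\infty m(r^{-k})<\infty$ for some $r>1$. Then the vertical curve $\Gamma\subset F^{-1}(0)$ is strongly Ahlfors regular.
   Context: The Heisenberg group $\mathbb H^1$ is $\mathbb R^3$ with the law $(x,y,z)(x',y',z')=(x+x',y+y',z+z'+2x'y-2xy')$, dilations $\delta_t(x,y,z)=(tx,ty,t^2z)$, and horizontal vector fields $X=\partial_x+2y\partial_z$, $Y=\partial_y-2x\partial_z$. Put $\rho_\infty(x,y,z)=\max\{\sqrt{x^2+y^2},|z|^{1/2}\}$ and $d_\infty(A,B)=\rho_\infty(B^{-1}A)$ (a left-invariant metric). A map $F:\mathbb H^1\to\mathbb R^k$ is horizontally differentiable at $A$ if there is a continuous group homomorphism $L:\mathbb H^1\to\mathbb R^k$ with $L(\delta_tB)=tL(B)$ ($t>0$) and $\|F(AB)-F(A)-L(B)\|=o(\rho_\infty(B))$ as $B\to0$; then $D_hF(A):=L$. $F\in C^1_H$ if this holds at every $A$ and $A\mapsto D_hF(A)$ is continuous. Vertical curve: if $F\in C^1_H(\mathbb H^1,\mathbb R^2)$, $F(0)=0$, $D_hF(0)$ surjective, a vertical curve is $\Gamma=F^{-1}(0)\cap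 U$, where $U$ is a sufficiently small compact neighbourhood of $0$, chosen so that $D_hF$ is surjective at every point of $U$, $\Gamma$ is a simple arc, and $d_\infty(A,B)^2=|z(A^{-1}B)|>0$ for distinct $A,B\in\Gamma$ ($z(\cdot)$ is the third coordinate); such $U$ exist. For $C,D\in\Gamma$, $[C,D]$ is the subarc between them. $\Gamma$ is strongly Ahlfors regular if, uniformly over $[C,D]\subset\Gamma$, $\mathcal H^2_\infty([C,D])=d_\infty(C,D)^2+o(d_\infty(C,D)^2)$ as $C\to D$, where $\mathcal H^2_\infty(E)=\lim_{\varepsilon\to0}\inf\{\sum_i(\operatorname{diam}E_i)^2: E\subset\bigcup_iE_i,\ \operatorname{diam}E_i\le\varepsilon\}$ (diameters for $d_\infty$, no normalizing constant). *)

(* Defs.v *)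
From HB Require Import structures.
From mathcomp Require Import all_boot all_order all_algebra.
From mathcomp Require Import all_classical all_reals all_analysis.

Set Implicit Arguments.
Unset Strict Implicit.
Unset Printing Implicit Defensive.

Import Order.TTheory GRing.Theory Num.Theory.
Import numFieldNormedType.Exports.

Local Open Scope classical_set_scope.
Local Open Scope ring_scope.

(* A notation, not a definition, so that the product topology of R^3 and the  *)
(* unit 0 = (0, 0, 0) are those of the library; the group law is [hmul].      *)
Notation heis R := (R * R * R)%type.

Section Heisenberg.
Context {R : realType}.
Implicit Types A B C D P : heis R.

Definition hx A : R := A.1.1.
Definition hy A : R := A.1.2.
Definition hz A : R := A.2.

Definition hmul A B : heis R :=
  (hx A + hx B, hy A + hy B, hz A + hz B + 2 * hx B * hy A - 2 * hx A * hy B).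

Definition hinv A : heis R := (- hx A, - hy A, - hz A).

Definition hdil (t : R) A : heis R := (t * hx A, t * hy A, t ^+ 2 * hz A).

Definition hrho A : R :=
  Num.max (Num.sqrt (hx A ^+ 2 + hy A ^+ 2)) (Num.sqrt `|hz A|).

Definition hdist A B : R := hrho (hmul (hinv B) A).

(* On 'rV[R]_k the library norm is the sup norm; being equivalent to the      *)
(* Euclidean one, it gives the same horizontal differentials and the same     *)
(* class C^1_H.                                                               *)
Definition hhom k (L : heis R -> 'rV[R]_k) : Prop :=
  [/\ continuous L,
      forall A B, L (hmul A B) = L A + L B &
      forall t B, 0 < t -> L (hdil t B) = t *: L B].

Definition is_hdiff k (F : heis R -> 'rV[R]_k) A (L : heis R -> 'rV[R]_k) :
    Prop :=
  hhom L /\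
  (fun B => F (hmul A B) - F A - L B) =o_ (0 : heis R) hrho.

Definition hdifferentiable k (F : heis R -> 'rV[R]_k) A : Prop :=
  exists L, is_hdiff F A L.

(* The horizontal differential is unique when it exists; the default value 0  *)
(* is only used where F is not horizontally differentiable.                   *)
Definition Dh k (F : heis R -> 'rV[R]_k) A : heis R -> 'rV[R]_k :=
  xget (fun=> 0) [set L | is_hdiff F A L].

(* Continuity of A |-> Dh F A is with respect to the operator norm            *)
(* sup_B |L B| / hrho B on the finite-dimensional space of homogeneous        *)
(* homomorphisms.                                                             *)
Definition C1H k (F : heis R -> 'rV[R]_k) : Prop :=
  (forall A, hdifferentiable F A) /\
  (forall A (e : R), 0 < e ->
    \forall A' \near A, forall B, `|Dh F A' B - Dh F A B| <= e * hrho B).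

(* X = d_x + 2y d_z and Y = d_y - 2x d_z are left invariant: their flows      *)
(* through A are t |-> A (t, 0, 0) and t |-> A (0, t, 0). A function of class *)
(* C^1_H need not have partial derivatives in z, so Xf and Yf are the         *)
(* derivatives of f along these flow lines.                                   *)
Definition hX (f : heis R -> R) A : R :=
  derive1 (fun t : R => f (hmul A (t, 0, 0))) 0.

Definition hY (f : heis R -> R) A : R :=
  derive1 (fun t : R => f (hmul A (0, t, 0))) 0.

Definition arc_param (gamma : R -> heis R) (Gamma : set (heis R)) : Prop :=
  [/\ {within `[0, 1], continuous gamma},
      set_inj `[0, 1] gamma &
      gamma @` `[0, 1] = Gamma].

Definition simple_arc (Gamma : set (heis R)) : Prop :=
  exists gamma, arc_param gamma Gamma.

(* For a simple arc the choice of gamma is immaterial, as two injective       *)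
(* parametrizations differ by a monotone homeomorphism of [0, 1].             *)
Definition subarc (Gamma : set (heis R)) C D : set (heis R) :=
  [set P | exists gamma (s t u : R),
    [/\ arc_param gamma Gamma,
        s \in `[0, 1] /\ gamma s = C,
        t \in `[0, 1] /\ gamma t = D &
        u \in `[Num.min s t, Num.max s t] /\ gamma u = P]].

Definition vertical_curve (F : heis R -> 'rV[R]_2) (Gamma : set (heis R)) :
    Prop :=
  [/\ C1H F, F 0 = 0, set_surj setT setT (Dh F 0) &
    exists U : set (heis R),
      [/\ compact U /\ nbhs (0 : heis R) U,
          Gamma = F @^-1` [set 0] `&` U,
          forall A, U A -> set_surj setT setT (Dh F A),
          simple_arc Gamma &
          forall A B, Gamma A -> Gamma B -> A <> B ->
            hdist A B ^+ 2 = `|hz (hmul (hinv A) B)| /\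
            0 < `|hz (hmul (hinv A) B)|]].

(* The added 0 makes the diameter of the empty set 0 rather than -oo.         *)
Definition hdiam (S : set (heis R)) : \bar R :=
  ereal_sup (0%E |` [set (hdist p.1 p.2)%:E | p in S `*` S]).

Definition hausdorff2_pre (e : R) (E : set (heis R)) : \bar R :=
  ereal_inf [set (\sum_(0 <= i <oo) hdiam (S i) ^+ 2)%E |
    S in [set S : nat -> set (heis R) |
      E `<=` \bigcup_i S i /\ forall i, (hdiam (S i) <= e%:E)%E]].

Definition hausdorff2 (E : set (heis R)) : \bar R :=
  lim (hausdorff2_pre e E @[e --> 0^'+]).

Definition strongly_ahlfors_regular (Gamma : set (heis R)) : Prop :=
  forall e : R, 0 < e -> exists2 delta : R, 0 < delta &
    forall C D, Gamma C -> Gamma D -> hdist C D < delta ->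
      (`|hausdorff2 (subarc Gamma C D) - (hdist C D ^+ 2)%:E|
         <= (e * hdist C D ^+ 2)%:E)%E.

End Heisenberg.

(* Main.v *)
Require Import Defs.
From HB Require Import structures.
From mathcomp Require Import all_boot all_order all_algebra.
From mathcomp Require Import all_classical all_reals all_analysis.
From mathcomp Require Import ring lra zify.

(** On a vertical curve the squared distance of two points A, B is the absolute
value of w(A, B) := z(A^-1 B), and w is additive up to twice the area spanned by
the horizontal parts u of A^-1 B and v of B^-1 C. Joining two points of the
curve by horizontal segments of length at most d shows that grad f is orthogonal
to their horizontal displacement up to O(d m(72 d^2)). As u and v are then both
almost parallel to the kernel of grad f, the area is O(d^2 m(72 d^2)).
By the Dini condition such defects are summable over dyadic scales, and a sewing
argument gives w(P_0, P_n) = sum_i w(P_i, P_(i+1)) + o(l) for all chains on the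
curve whose total length l = sum_i |w(P_i, P_(i+1))| is small. Fine partitions of
a subarc provide coverings, hence the upper bound for the Hausdorff measure. For
the lower bound, the infimum of the lengths of the chains from C to P is a
function of P that is 1-Lipschitz for d^2, vanishes at C and is at least
(1 - o(1)) d(C, D)^2 at D; it carries any covering of the subarc to a covering
of a real interval. *)

Set Implicit Arguments.
Unset Strict Implicit.
Unset Printing Implicit Defensive.

Import Order.TTheory GRing.Theory Num.Theory.
Import numFieldNormedType.Exports.

Local Open Scope classical_set_scope.
Local Open Scope ring_scope.

(** * Sewing *)

(* T w stands for the series of the k (4 w / 2 ^ j); the factor 4 absorbs the
   constant of the quasi-triangle inequality. *)
Record dini_gauge (R : realFieldType) (k T : R -> R) : Prop := DiniGauge {
  gauge_ge0 : forall s : R, 0 <= s -> 0 <= k s;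
  gauge_mono : forall s t : R, 0 <= s -> s <= t -> k s <= k t;
  tail_mono : forall s t : R, 0 <= s -> s <= t -> T s <= T t;
  tail_ge0 : forall s : R, 0 <= s -> 0 <= T s;
  tail_half : forall w : R, 0 <= w -> T (w / 2) + k (4 * w) <= T w;
  tail_small : forall e : R, 0 < e -> exists2 d : R, 0 < d & T d <= e }.

(** The abstract form of w on a curve: [|o|] is a squared distance, hence the factor 2 in its
    triangle inequality, and [k w] is the defect of additivity relative to the scale [w]. *)
Record quasi_additive (R : realFieldType) (I : Type) (o : I -> I -> R) (k : R -> R) : Prop :=
  QuasiAdditive {
  qadd_diag : forall i, o i i = 0;
  qadd_quasi : forall i j l, `|o i l| <= 2 * (`|o i j| + `|o j l|);
  qadd_defect : forall i j l (w : R), `|o i j| <= w -> `|o j l| <= w ->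
    `|o i l - o i j - o j l| <= w * k w }.

(* The chain is cut at the step where its partial length passes half of the
   total, so both remaining chains have at most half the length. *)
Lemma sewing (R : realFieldType) (o : nat -> nat -> R) (k T : R -> R)
    (len := fun a n => \sum_(a <= i < a + n) `|o i i.+1| : R) a n :
  quasi_additive o k -> dini_gauge k T -> 5 * T (len a n) <= 1 ->
  `|o a (a + n)%N - \sum_(a <= i < a + n) o i i.+1| <= 5 * len a n * T (len a n).
Proof.
move=> [ o_diag o_quasi o_defect] [k_ge0 k_mono T_mono T_ge0 T_half _].
have len_ge0 a' n' : 0 <= len a' n' by exact: sumr_ge0.
have lenD a' n1 n2 : len a' (n1 + n2)%N = len a' n1 + len (a' + n1)%N n2.
  by rewrite /len (@big_cat_nat _ _ _ (a' + n1)) ?leq_addr //= ?addnA // leq_addr.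
have len1 a' : len a' 1%N = `|o a' a'.+1| by rewrite /len addn1 big_nat1.
have [N] := ubnP n; elim: N => // N IH in a n *.
rewrite ltnS => nN; case: n => [|n] in nN *.
  move=> _; rewrite addn0 o_diag big_geq // subr0 normr0.
  by rewrite !mulr_ge0 // ?T_ge0.
move=> hT; set S : R := len a n.+1 in hT *.
have S0 : 0 <= S by exact: len_ge0.
(* For the smallest such [j = i + 1], the first [i] steps and the steps after the next one both have
   length at most [S / 2]; the step in between may be long. *)
have exP : exists j, (0 < j)%N && (S <= 2 * len a j).
  by exists n.+1; rewrite /= /S; have := len_ge0 a n.+1; lra.
case: (ex_minnP exP) => -[//|i] /= Si imin.
have i_le : (i <= n)%N.
  by have := imin n.+1; rewrite /= -/S ltnS; apply; lra.
have S1h : 2 * len a i <= S.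
  case: i imin {Si i_le} => [|i] imin; first by rewrite /len addn0 big_geq // mulr0.
  by rewrite leNgt; apply/negP => /ltW h; have := imin i.+1; rewrite /= h ltnn => /(_ isT).
have [n' def_n] : exists n', n = (i + n')%N by exists (n - i)%N; rewrite subnKC.
have En : n.+1 = (i + (1 + n'))%N by lia.
have dS : S = len a i + `|o (a + i)%N (a + i).+1| + len (a + i).+1 n'.
  by rewrite /S En !lenD len1 addrA addn1.
have dS' : len a i.+1 = len a i + `|o (a + i)%N (a + i).+1|.
  by rewrite -addn1 lenD len1.
move: (len_ge0 a i) (len_ge0 (a + i).+1 n').
have : `|o (a + i)%N (a + i).+1| >= 0 by [].
have -> : \sum_(a <= j < a + n.+1) o j j.+1 =
   \sum_(a <= j < a + i) o j j.+1 + o (a + i)%N (a + i).+1 +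
   \sum_((a + i).+1 <= j < (a + i).+1 + n') o j j.+1.
  rewrite (@big_cat_nat _ _ _ (a + i)) ?leq_addr //=; last by lia.
  rewrite -addrA; congr (_ + _).
  rewrite big_ltn; last by lia.
  by congr (_ + bigop _ _ _); congr index_iota; lia.
have -> : (a + n.+1)%N = ((a + i).+1 + n')%N by lia.
have IH1 := IH a i (leq_ltn_trans i_le nN).
have IH3 := IH (a + i).+1 n'.
set S1 : R := len a i in dS dS' IH1 S1h *; set S3 : R := len _ n' in dS IH3 *.
set S2 : R := `|_| in dS dS' * => S20 S10 S30.
have S3h : 2 * S3 <= S by lra.
have TS := T_half _ S0.
have k0S : k S <= k (4 * S) by apply: k_mono => //; lra.
have k0 : 0 <= k (4 * S) by apply: k_ge0; lra.
have T1 : T S1 <= T (S / 2) by apply: T_mono => //; lra.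
have T3 : T S3 <= T (S / 2) by apply: T_mono => //; lra.
have {}IH1 := IH1 ltac:(lra).
have n'N : (n' < N)%N by apply: leq_ltn_trans nN; rewrite def_n leq_addl.
have {}IH3 := IH3 n'N ltac:(lra).
clear imin IH exP dS' En def_n nN n'N i_le Si.
have sum1 : `|\sum_(a <= j < a + i) o j j.+1| <= S1 by exact: ler_norm_sum.
have sum3 : `|\sum_((a + i).+1 <= j < (a + i).+1 + n') o j j.+1| <= S3.
  by exact: ler_norm_sum.
move: IH1 IH3 sum1 sum3.
set X1 := \sum_(a <= _ < a + i) _; set X3 := \sum_(_ <= _ < _ + n') _ => IH1 IH3 sum1 sum3.
have {IH1}e1 : `|o a (a + i)%N - X1| <= 5 * S1 * T (S / 2).
  by apply: (le_trans IH1); apply: ler_wpM2l => //; lra.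
have {IH3}e3 : `|o (a + i).+1 ((a + i).+1 + n')%N - X3| <= 5 * S3 * T (S / 2).
  by apply: (le_trans IH3); apply: ler_wpM2l => //; lra.
have T0 : 0 <= T (S / 2) by apply: T_ge0; lra.
(* Since [5 T(S) <= 1], the error on a remaining chain is at most its length, so [|o|] between its
   ends is at most twice this length, hence at most [S]. *)
have le_dbl (x : R) : 0 <= x -> 5 * x * T (S / 2) <= x.
  by move=> x0; rewrite -mulrA mulrCA ler_piMr //; move: hT k0 TS; clear; lra.
have q1 : `|o a (a + i)%N| <= S.
  have := ler_normD (o a (a + i)%N - X1) X1; rewrite subrK.
  by have := le_dbl _ S10; lra.
have q3 : `|o (a + i).+1 ((a + i).+1 + n')%N| <= S.
  have := ler_normD (o (a + i).+1 ((a + i).+1 + n')%N - X3) X3; rewrite subrK.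
  by have := le_dbl _ S30; lra.
have q2 : `|o (a + i)%N (a + i).+1| <= S by rewrite -/S2; lra.
have q12 : `|o a (a + i).+1| <= 4 * S.
  by have := o_quasi a (a + i)%N (a + i).+1; lra.
have d1 := o_defect _ _ _ _ q1 q2.
have d2 := o_defect _ _ _ _ q12 (le_trans q3 (ltac:(lra) : S <= 4 * S)).
set x01 := o a (a + i)%N in e1 d1 *; set x02 := o a _ in d1 d2.
set x12 := o _ (a + i).+1 in d1 *; set x23 := o _ _ in e3 d2; set x03 := o _ _ in d2 *.
(* Inserting the two cut points costs [S k(S)] and then [4 S k(4 S)], together at most [5 S k(4 S)]:
   this is the constant 5. By [tail_half] this cost and the errors of the two chains fit into
   [5 S T(S)]. *)
have -> : x03 - (X1 + x12 + X3) =
  (x03 - x02 - x23) + (x02 - x01 - x12) + (x01 - X1) + (x23 - X3) by ring.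
apply: le_trans (ler_normD _ _) _; apply: le_trans (lerD (ler_normD _ _) e3) _.
apply: le_trans (lerD (lerD (ler_normD _ _) e1) (lexx _)) _.
apply: le_trans (lerD (lerD (lerD d2 d1) (lexx _)) (lexx _)) _.
have h1 : S * k S <= S * k (4 * S) by apply: ler_wpM2l.
have h2 : S * (T (S / 2) + k (4 * S)) <= S * T S by apply: ler_wpM2l.
have h3 : (S1 + S3) * T (S / 2) <= S * T (S / 2) by apply: ler_wpM2r => //; lra.
by move: h1 h2 h3 k0; clear -TS S0; lra.
Qed.

(** * Tails of Dini series *)

Lemma exprn_unbounded (R : realType) (r x : R) : 1 < r -> exists n, x <= r ^+ n.
Proof.
move=> r1; have r0 : 0 < r by apply: lt_trans r1.
have [x0|x0] := leP x 0; first by exists 0%N; rewrite expr0 (le_trans x0).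
have : r^-1 ^+ n @[n --> \oo] --> (0 : R).
  by apply: cvg_expr; rewrite ger0_norm ?invr_ge0 ?ltW// invf_lt1.
move=> /cvgrPdist_lt /(_ x^-1); rewrite invr_gt0 => /(_ x0) [n _ /(_ n (leqnn _))].
rewrite sub0r normrN ger0_norm ?exprn_ge0 ?invr_ge0 ?ltW// exprVn => h.
by exists n; rewrite ltW // -ltf_pV2 // posrE exprn_gt0.
Qed.

Section DiniTail.
Variables (R : realType) (m : R -> R) (r : R).
Hypothesis m_ge0 : forall t, 0 <= t -> 0 <= m t.
Hypothesis m_mono : forall s t, 0 <= s -> s <= t -> m s <= m t.
Hypothesis r_gt1 : 1 < r.
Hypothesis m_sum : cvgn (series (fun k : nat => m (r ^- k))).

Let r_gt0 : 0 < r. Proof. exact: lt_trans r_gt1. Qed.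

Let halving w j : 0 <= w -> 0 <= w / 2 ^+ j :> R.
Proof. by move=> w0; rewrite divr_ge0 // exprn_ge0. Qed.

(** A block of [p] halvings shrinks at least as much as one division by [r], so by monotonicity
    every term of the [i]-th block is at most [m (w / r ^+ i)]. *)
Lemma dyadic_sum_le_block p w J : r <= 2 ^+ p -> 0 <= w ->
  \sum_(0 <= j < p * J) m (w / 2 ^+ j) <= p%:R * \sum_(0 <= i < J) m (w / r ^+ i).
Proof.
move=> rp w0; elim: J => [|J IH]; first by rewrite muln0 !big_geq // mulr0.
rewrite big_nat_recr //= mulrDr mulnS addnC (@big_cat_nat _ _ _ (p * J)) ?leq_addr //=.
apply: lerD => //.
rewrite mulr_natl -[p in X in _ <= X](addKn (p * J) p) -sumr_const_nat.
rewrite !big_nat; apply: ler_sum => j /andP[jl _].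
apply: m_mono; first exact: halving.
apply: ler_wpM2l => //; rewrite lef_pV2 ?posrE ?exprn_gt0 //.
apply: (@le_trans _ _ (2 ^+ (p * J))); first by rewrite exprM lerXn2r // nnegrE ?exprn_ge0 // ltW.
by rewrite ler_eXn2l // ltr1n.
Qed.

(** Once [w <= r ^+ n], the argument [w / r ^+ (i + n)] is at most [r ^- i], so summability along
    the powers of [r] bounds the dyadic sums from any start [w]. *)
Lemma dyadic_sum_cvg w : 0 <= w -> cvgn (series (fun j => m (w / 2 ^+ j))).
Proof.
move=> w0.
have [p rp] := @exprn_unbounded R 2 r (ltr1n _ _).
have [n wn] := exprn_unbounded w r_gt1.
have p0 : (0 < p)%N by case: p rp => //; rewrite expr0 leNgt r_gt1.
apply: nondecreasing_is_cvgn.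
  by apply/nondecreasing_seqP => j; rewrite seriesSr lerDl m_ge0 // halving.
set L := limn (series (fun k : nat => m (r ^- k))).
exists (p%:R * (\sum_(0 <= i < n) m (r ^+ n) + L)) => _ [J _ <-].
apply: (@le_trans _ _ (series (fun j => m (w / 2 ^+ j)) (p * (n + J)))).
  rewrite /series /= (@big_cat_nat _ _ _ J _ (p * (n + J))) //=; last first.
    by rewrite (leq_trans (leq_addl n J)) // leq_pmull.
  by rewrite lerDl; apply: sumr_ge0 => j _; rewrite m_ge0 // halving.
apply: le_trans (dyadic_sum_le_block _ rp w0) _; apply: ler_wpM2l => //.
rewrite (@big_cat_nat _ _ _ n) ?leq_addr //=; apply: lerD.
  apply: ler_sum => i _; apply: m_mono; first by rewrite divr_ge0 // exprn_ge0 // ltW.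
  by rewrite ler_pdivrMr ?exprn_gt0 // (le_trans wn) // ler_peMr ?exprn_ge0 ?exprn_ege1 // ltW.
have -> : \sum_(n <= i < n + J) m (w / r ^+ i) = \sum_(0 <= i < J) m (w / r ^+ (i + n)).
  by rewrite -{1}[n]add0n big_addn addKn.
apply: (@le_trans _ _ (series (fun k => m (r ^- k)) J)).
  apply: ler_sum => i _; apply: m_mono; first by rewrite divr_ge0 // exprn_ge0 // ltW.
  rewrite ler_pdivrMr ?exprn_gt0 // exprD mulrA mulVf ?mul1r //.
  by rewrite expf_neq0 // gt_eqF.
apply: nondecreasing_cvgn_le => //.
by apply/nondecreasing_seqP => j; rewrite seriesSr lerDl m_ge0 // invr_ge0 exprn_ge0 // ltW.
Qed.

(** [T w] is [c] times the sum of the [m (a w / 2 ^ j)]: halving [w] drops the first term, and the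
    value at [2 ^ (- n)] is a tail of the convergent series at 1. *)
Lemma dini_tail (c a : R) : 0 <= c -> 0 <= a -> exists T : R -> R,
  [/\ forall s t, 0 <= s -> s <= t -> T s <= T t,
      forall s, 0 <= s -> 0 <= T s,
      forall w, 0 <= w -> T (w / 2) + c * m (a * w) <= T w &
      forall e, 0 < e -> exists2 d, 0 < d & T d <= e].
Proof.
move=> c0 a0; pose S w := series (fun j => m (a * w / 2 ^+ j)).
have Scvg w : 0 <= w -> cvgn (S w) by move=> w0; apply: dyadic_sum_cvg; rewrite mulr_ge0.
have aw0 w j : 0 <= w -> 0 <= a * w / 2 ^+ j by move=> w0; rewrite halving // mulr_ge0.
have Srec w : 0 <= w -> limn (S w) = m (a * w) + limn (S (w / 2)).
  move=> w0; apply/cvg_lim => //; rewrite -(cvg_shiftS (S w)).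
  have -> : [sequence S w n.+1]_n = (fun n => m (a * w) + S (w / 2) n).
    apply/funext => n; rewrite /= /S /series /= big_nat_recl // expr0 divr1; congr (_ + _).
    by apply: eq_bigr => i _; congr m; rewrite exprS invfM !mulrA.
  by apply: cvgD; [exact: cvg_cst|apply: Scvg; rewrite divr_ge0].
exists (fun w => c * limn (S w)); split.
- move=> s t s0 st; apply: ler_wpM2l => //.
  apply: lim_series_le; rewrite -/(S _); try by apply: Scvg => //; exact: le_trans st.
  move=> n; apply: m_mono; first exact: aw0.
  by rewrite ler_wpM2r ?invr_ge0 ?exprn_ge0 // ler_wpM2l.
- move=> s s0; rewrite mulr_ge0 // (limr_ge (Scvg _ s0)) //; near=> n.
  by apply: sumr_ge0 => i _; rewrite m_ge0 // aw0.
- by move=> w w0; rewrite (Srec w) // mulrDr addrC.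
move=> e e0.
have Sn n : limn (S (1 / 2 ^+ n)) = limn (S 1) - S 1 n.
  elim: n => [|n IH]; first by rewrite expr0 divr1 /S /series /= big_geq // subr0.
  have := Srec (1 / 2 ^+ n); rewrite IH halving // => /(_ isT).
  have -> : 1 / 2 ^+ n / 2 = 1 / 2 ^+ n.+1 :> R by rewrite -mulrA -invfM -exprSr.
  have -> : S 1 n.+1 = S 1 n + m (a * (1 / 2 ^+ n)) by rewrite /S seriesSr mulrA.
  by move=> h; lra.
(* The divisor is [c + 1] because [c] may vanish. *)
have /cvgrPdist_lt /(_ (e / (c + 1))) := Scvg _ (@ler01 R).
case=> [|n _ /(_ n (leqnn _)) /= h]; first by rewrite divr_gt0 // ltr_wpDl.
exists (1 / 2 ^+ n); first by rewrite divr_gt0 // exprn_gt0.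
rewrite Sn; have c1 : 0 < c + 1 by rewrite ltr_wpDl.
apply: (@le_trans _ _ ((c + 1) * (e / (c + 1)))); last by rewrite mulrC divfK // gt_eqF.
apply: (@le_trans _ _ (c * (e / (c + 1)))).
  by apply: ler_wpM2l => //; exact: le_trans (ler_norm _) (ltW h).
by apply: ler_wpM2r; [rewrite divr_ge0 // ltW|rewrite lerDl].
Unshelve. all: by end_near. Qed.

End DiniTail.

(** * Quasi-additive functions on an arc *)

(** Twice the positive part of [e - b], added to [a], is a function [g] that is positive on the
    square, so its minimum is positive by compactness; where [b >= e] it reduces to [a]. *)
Lemma unit_square_control (R : realType) (a b : R * R -> R) (e : R) :
  continuous a -> continuous b -> (forall p, 0 <= a p) ->
  (forall s t : R, 0 <= s <= 1 -> 0 <= t <= 1 -> 0 < b (s, t) -> 0 < a (s, t)) ->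
  0 < e -> exists2 d : R, 0 < d & forall s t : R, 0 <= s <= 1 -> 0 <= t <= 1 ->
    a (s, t) < d -> b (s, t) < e.
Proof.
move=> ca cb a0 ab e0.
pose g p := a p + (`|e - b p| + (e - b p)).
have cg : continuous g.
  move=> p; have eb : continuous_at p (fun q => e - b q).
    by apply: cvgB; [exact: cvg_cst|exact: cb].
  by apply: cvgD; [exact: ca|apply: cvgD => //; exact: cvg_norm].
have [|||[c1 c2]] := @compact_EVT_min _ R g (`[0, 1] `*` `[0, 1]).
- by exists (0, 0); split; rewrite /= in_itv /= lexx ler01.
- by apply: compact_setX; exact: segment_compact.
- by apply: continuous_subspaceT.
rewrite inE => -[/=]; rewrite !in_itv /= => h1 h2 gmin.
have h (x : R) : 0 <= `|x| + x by have := ler_norm (- x); rewrite normrN; lra.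
exists (g (c1, c2)).
  rewrite /g; have [b0|b0] := ltP 0 (b (c1, c2)).
    by have := ab _ _ h1 h2 b0; have := h (e - b (c1, c2)); lra.
  by have := a0 (c1, c2); have := normr_ge0 (e - b (c1, c2)); lra.
move=> s t hs ht ast; rewrite ltNge; apply/negP => eb.
have := gmin (s, t); rewrite inE /= !in_itv /= => /(_ (conj hs ht)).
by rewrite [g (s, t)]/g ler0_norm; lra.
Qed.

(** All fields but the last are required on the whole line, since the curve will be extended by
    constants beyond [0, 1]; strict positivity can only hold inside. *)
Record quasi_additive_arc (R : realType) (o : R -> R -> R) (k : R -> R) : Prop :=
  QuasiAdditiveArc {
  arc_qadd : quasi_additive o k;
  arc_cont : continuous (fun p : R * R => o p.1 p.2);
  arc_anti : forall s t, o t s = - o s t;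
  arc_pos : forall s t : R, 0 <= s -> s < t -> t <= 1 -> 0 < o s t }.

Lemma arc_ge0 (R : realType) (o : R -> R -> R) (k : R -> R) (s t : R) : quasi_additive_arc o k ->
  0 <= s -> s <= t -> t <= 1 -> 0 <= o s t.
Proof.
move=> [[ o_diag _ _] _ _ o_pos] s0; rewrite le_eqVlt => /predU1P[<- _|st t1].
  by rewrite o_diag.
by rewrite ltW // o_pos.
Qed.

Lemma arc_normE (R : realType) (o : R -> R -> R) (k : R -> R) (s t : R) : quasi_additive_arc o k ->
  0 <= s -> s <= t -> t <= 1 -> `|o s t| = o s t.
Proof. by move=> H s0 st t1; rewrite ger0_norm // (arc_ge0 H). Qed.

Lemma arc_abs_cont (R : realType) (o : R -> R -> R) (k : R -> R) : quasi_additive_arc o k ->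
  continuous (fun p : R * R => `|o p.1 p.2|).
Proof. by move=> [_ o_cont _ _] p; apply: cvg_norm; exact: o_cont. Qed.

Lemma abs_sub_cont (R : realType) : continuous (fun p : R * R => `|p.1 - p.2|).
Proof. by move=> p; apply: cvg_norm; apply: cvgB; [exact: cvg_fst|exact: cvg_snd]. Qed.

Lemma arc_unif_cont (R : realType) (o : R -> R -> R) (k : R -> R) (e : R) :
  quasi_additive_arc o k -> 0 < e -> exists2 d : R, 0 < d & forall s t : R,
  0 <= s <= 1 -> 0 <= t <= 1 -> `|s - t| < d -> `|o s t| < e.
Proof.
move=> H e0; have abs_o_cont := arc_abs_cont H; have [[ o_diag _ _] _ _ _] := H.
apply: (@unit_square_control R (fun p => `|p.1 - p.2|) (fun p => `|o p.1 p.2|)) => //;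
  first exact: abs_sub_cont.
move=> s t _ _ /=; rewrite !normr_gt0 subr_eq0; apply: contra => /eqP ->.
by rewrite o_diag.
Qed.

(** A converse of [arc_unif_cont]: on the square [o] vanishes only on the diagonal. *)
Lemma arc_inj_unif (R : realType) (o : R -> R -> R) (k : R -> R) (e : R) :
  quasi_additive_arc o k -> 0 < e -> exists2 d : R, 0 < d & forall s t : R,
  0 <= s <= 1 -> 0 <= t <= 1 -> `|o s t| < d -> `|s - t| < e.
Proof.
move=> H e0; have abs_o_cont := arc_abs_cont H; have [_ _ o_anti o_pos] := H.
apply: (@unit_square_control R (fun p => `|o p.1 p.2|) (fun p => `|p.1 - p.2|)) => //;
  first exact: abs_sub_cont.
move=> s t /andP[s0 s1] /andP[t0 t1] /=; rewrite !normr_gt0 subr_eq0.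
case: ltgtP => // [st|ts] _; first by rewrite gt_eqF // o_pos.
by rewrite o_anti oppr_eq0 gt_eqF // o_pos.
Qed.

(** Almost monotonicity of [o]. If [M] is the largest of the three summands, the two defects cost at
    most [5 M T(d) <= e M], while the nonnegative summands add up to at least [M]. *)
Lemma arc_sub_le (R : realType) (o : R -> R -> R) (k T : R -> R) (d e s u v t : R) :
  quasi_additive_arc o k -> dini_gauge k T -> 0 <= s -> s <= u -> u <= v -> v <= t -> t <= 1 ->
  o s u <= d -> o u v <= d -> o v t <= d -> 5 * T d <= e ->
  (1 - e) * o u v <= o s t.
Proof.
move=> H [_ k_mono T_mono T_ge0 T_half _] s0 su uv vt t1 dsu duv dvt Td.
have [[_ o_quasi o_defect] _ _ _] := H.
have [u0 v1] : 0 <= u /\ v <= 1 by split; [exact: le_trans su|exact: le_trans t1].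
have v0 : 0 <= v := le_trans u0 uv.
have [xsu xuv xvt] : [/\ 0 <= o s u, 0 <= o u v & 0 <= o v t].
  by split; apply: (arc_ge0 H) => //; exact: le_trans v1.
pose M : R := Num.max (o s u) (Num.max (o u v) (o v t)).
have M1 : `|o s u| <= M by rewrite ger0_norm // le_max lexx.
have M2 : `|o u v| <= M by rewrite ger0_norm // !le_max lexx orbT.
have M3 : `|o v t| <= M by rewrite ger0_norm // !le_max lexx !orbT.
have Md : M <= d by rewrite !ge_max dsu duv dvt.
have M0 : 0 <= M := le_trans (normr_ge0 _) M1.
have d1 := o_defect _ _ _ _ M1 M2.
have M4 : `|o s v| <= 4 * M by have := o_quasi s u v; lra.
have d2 := o_defect _ _ _ _ M4 (le_trans M3 (ltac:(lra) : M <= 4 * M)).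
have kM : k M <= k (4 * M) by apply: k_mono => //; move: M0; clear; lra.
have kT : k (4 * M) <= T d.
  have M20 : 0 <= M / 2 by rewrite divr_ge0.
  by have := T_half _ M0; have := T_mono _ _ M0 Md; have := T_ge0 _ M20; clear; lra.
have Msum : M <= o s u + o u v + o v t
  by rewrite !ge_max; move: xsu xuv xvt; clear => *; apply/and3P; split; lra.
have h1 : M * k M <= M * T d by apply: ler_wpM2l => //; lra.
have h2 : M * k (4 * M) <= M * T d by apply: ler_wpM2l.
have h3 : M * (5 * T d) <= M * e by apply: ler_wpM2l.
have h4 : o u v <= M by rewrite -(ger0_norm xuv).
have big : M - M * e <= o s t.
  by move: d1 d2; rewrite !ler_norml => /andP[+ _] /andP[+ _]; move: h1 h2 h3 Msum; clear; lra.
have [e1|e1] := leP e 1; last first.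
  apply: le_trans (arc_ge0 H s0 (le_trans su (le_trans uv vt)) t1).
  by rewrite mulr_le0_ge0 // subr_le0 ltW.
apply: le_trans big; have -> : M - M * e = (1 - e) * M by ring.
by apply: ler_wpM2l => //; rewrite subr_ge0.
Qed.

(** Sewing for the pullback of [o] along [p]; the chain may backtrack or repeat points. *)
Lemma chain_length (R : realFieldType) (I : Type) (o : I -> I -> R) (k T : R -> R)
    (p : nat -> I) n (d : R) (S := \sum_(0 <= i < n) `|o (p i) (p i.+1)| : R) :
  quasi_additive o k -> dini_gauge k T -> S <= d -> 5 * T d <= 1 ->
  `|o (p 0%N) (p n) - \sum_(0 <= i < n) o (p i) (p i.+1)| <= 5 * T d * S.
Proof.
move=> [ o_diag o_quasi o_defect] G Sd Td; have [_ _ T_mono _ _ _] := G.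
have S0 : 0 <= S by apply: sumr_ge0.
have TS : T S <= T d by apply: T_mono.
have qadd_p : quasi_additive (fun i j => o (p i) (p j)) k.
  by split=> *; [exact: o_diag|exact: o_quasi|exact: o_defect].
have := sewing (a := 0) (n := n) qadd_p G.
rewrite !add0n -/S => /(_ ltac:(lra)) h.
apply: (le_trans h); rewrite -mulrA [S * _]mulrC mulrA.
by apply: ler_wpM2r => //; lra.
Qed.

(** The parameter interval is cut into equal pieces. [arc_sub_le] bounds [|o|] on a whole piece by
    its value at the endpoints, and sewing compares the sum of these values with [o s t]. *)
Lemma arc_fine_partition (R : realType) (o : R -> R -> R) (k T : R -> R) (e : R) :
  quasi_additive_arc o k -> dini_gauge k T -> 0 < e -> e <= 1 -> exists2 d : R, 0 < d &
  forall s t : R, 0 <= s -> s <= t -> t <= 1 -> o s t < d -> forall h : R, 0 < h ->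
  exists N (p L : nat -> R), [/\ (0 < N)%N /\ p 0%N = s, p N = t,
    forall i, (i < N)%N -> p i <= p i.+1 /\ 0 <= L i <= h,
    forall i (u v : R), (i < N)%N -> p i <= u <= p i.+1 -> p i <= v <= p i.+1 ->
      `|o u v| <= L i &
    \sum_(0 <= i < N) L i <= (1 + e) * o s t].
Proof.
move=> H G e0 e1; have [[ o_diag _ _] _ o_anti _] := H.
have o_normE a b := @arc_normE _ _ _ a b H; have o_ge0 a b := @arc_ge0 _ _ _ a b H.
have [d0 d00 Td0] := tail_small G (ltac:(lra) : 0 < e / 40).
have Te : 5 * T d0 <= e / 8 by lra.
have Te1 : 5 * T d0 <= 1 by lra.
have d0h : d0 / 2 <= d0 by lra.
have [r r0 hr] := arc_unif_cont H (ltac:(lra) : 0 < d0 / 8).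
have [d d_gt0 hd] := arc_inj_unif H r0.
exists d => // s t s0 st t1 ostd h h0.
have ts_r : `|s - t| < r.
  apply: hd; first by rewrite s0 (le_trans st).
    by rewrite t1 (le_trans s0).
  by rewrite o_normE.
have small u v : s <= u -> u <= t -> s <= v -> v <= t -> `|o u v| < d0 / 8.
  move=> su ut sv vt; apply: hr.
  - by rewrite (le_trans s0) // (le_trans ut).
  - by rewrite (le_trans s0) // (le_trans vt).
  apply: le_lt_trans ts_r; rewrite [`|s - t|]ler0_norm ?subr_le0 // ler_norml.
  by apply/andP; split; lra.
have [q q0 hq] := arc_unif_cont H (ltac:(lra) : 0 < h / 2).
have [n qn] := @exprn_unbounded R 2 (2 / q) (ltr1n _ _).
pose N := (2 ^ n)%N; have N0 : 0 < N%:R :> R by rewrite ltr0n expn_gt0.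
pose w : R := (t - s) / N%:R.
have w0 : 0 <= w by rewrite divr_ge0 ?ler0n // subr_ge0.
have wq : w < q.
  rewrite ltr_pdivrMr // mulrC; apply: (@lt_le_trans _ _ 2); first lra.
  by rewrite natrX -ler_pdivrMr.
pose p i : R := s + w * i%:R.
have pS i : p i.+1 = p i + w by rewrite /p -natr1 mulrDr mulr1 addrA.
have p_le i : p i <= p i.+1 by rewrite pS lerDl.
have sp i : s <= p i by rewrite lerDl mulr_ge0.
have pN : p N = t by rewrite /p /w divfK ?gt_eqF // addrC subrK.
have pt i : (i <= N)%N -> p i <= t.
  by move=> iN; rewrite -pN lerD2l ler_wpM2l // ler_nat.
have p0i i : 0 <= p i by exact: le_trans (sp i).
have p1 i : (i <= N)%N -> p i <= 1 by move=> iN; exact: le_trans (pt _ iN) t1.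
have abs_sum j : (j <= N)%N ->
    \sum_(0 <= i < j) `|o (p i) (p i.+1)| = \sum_(0 <= i < j) o (p i) (p i.+1).
  move=> jN; apply: eq_big_nat => i /andP[_ ij].
  by rewrite o_normE // p1 // (leq_trans ij).
have p00 : p 0%N = s by rewrite /p mulr0 addr0.
have sum_le j : (j <= N)%N -> \sum_(0 <= i < j) `|o (p i) (p i.+1)| <= d0 ->
    (1 - e / 8) * \sum_(0 <= i < j) `|o (p i) (p i.+1)| <= o s (p j).
  move=> jN Sd; have := chain_length (arc_qadd H) G Sd Te1.
  rewrite -abs_sum // p00; set S : R := \sum_(_ <= _ < _) _ => hS.
  have S0 : 0 <= S by exact: sumr_ge0.
  have := ler_wpM2r S0 Te; move: hS; rewrite ler_norml => /andP[+ _]; clear.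
  by lra.
(* Sewing needs an a priori bound on the length. By induction, one more term keeps the sum below
   [d0], and [sum_le] then brings it back below [d0 / 2]. *)
have sum_d0 j : (j <= N)%N -> \sum_(0 <= i < j) `|o (p i) (p i.+1)| <= d0 / 2.
  elim: j => [|j IH] jN; first by rewrite big_geq // divr_ge0 // ltW.
  have oj : `|o (p j) (p j.+1)| < d0 / 8 by apply: small => //; apply: pt => //; exact: ltnW.
  have Sd : \sum_(0 <= i < j.+1) `|o (p i) (p i.+1)| <= d0.
    by rewrite big_nat_recr //=; move: oj d00 (IH (ltnW jN)); clear; lra.
  have := sum_le _ jN Sd; have := small s (p j.+1) (lexx s) st (sp _) (pt _ jN).
  rewrite o_normE ?p1 //; set S : R := \sum_(_ <= _ < _) _ in Sd *.
  have S0 : 0 <= S by exact: sumr_ge0.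
  have e12 : e / 8 <= 1 / 2 by move: e1; clear; lra.
  by have := ler_wpM2r S0 e12; move: d00; clear; lra.
(* The factor [1 + e / 4] makes up for the loss [1 - e / 8] in [arc_sub_le], and is still at most
   [(1 + e) (1 - e / 8)], as the total requires. *)
exists N, p, (fun i => (1 + e / 4) * `|o (p i) (p i.+1)|); split => //.
- by rewrite /N expn_gt0.
- move=> i iN; split => //; rewrite mulr_ge0 //=; last by move: e0; clear; lra.
  have : `|o (p i) (p i.+1)| < h / 2.
    apply: hq; rewrite ?p0i ?p1 // ?(ltnW iN) //.
    by rewrite pS opprD addrA subrr sub0r normrN ger0_norm.
  have := normr_ge0 (o (p i) (p i.+1)); move: `|_| => x x0 xh.
  have e14 : e / 4 <= 1 / 4 by move: e1; clear; lra.
  by have := ler_wpM2r x0 e14; move: xh h0; clear; lra.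
- move=> i u v iN; wlog uv : u v / u <= v.
    move=> hw hu hv; have [uv|/ltW vu] := leP u v; first exact: hw.
    by rewrite o_anti normrN; exact: hw.
  move=> /andP[pu up] /andP[pv vp].
  have smalli x y : p i <= x -> x <= p i.+1 -> p i <= y -> y <= p i.+1 -> o x y <= d0.
    move=> px xp py yp; apply: le_trans (ler_norm _) _.
    have : `|o x y| < d0 / 8; last by move: d00; clear; lra.
    by apply: small; rewrite ?(le_trans (sp i)) // (le_trans _ (pt i.+1 iN)).
  have := @arc_sub_le _ _ _ _ d0 (e / 8) (p i) u v (p i.+1) H G (p0i i) pu uv vp (p1 _ iN).
  rewrite !smalli // => /(_ isT isT isT Te).
  rewrite !o_normE ?p1 //; last 2 first.
  - exact: le_trans pu.
  - exact: le_trans (p1 _ iN).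
  move=> ouv; have x0 : 0 <= o u v.
    by apply: o_ge0 => //; [exact: le_trans pu|exact: le_trans (p1 _ iN)].
  have e2 : e * e <= e by rewrite ler_piMl // ltW.
  have c1 : 1 <= (1 + e / 4) * (1 - e / 8) by move: e0 e2; clear; lra.
  have := ler_wpM2r x0 c1; rewrite mul1r => /le_trans; apply; rewrite -mulrA.
  by apply: ler_wpM2l => //; move: e0; clear; lra.
- rewrite -mulr_sumr.
  have := sum_le _ (leqnn N) (le_trans (sum_d0 _ (leqnn N)) d0h).
  rewrite pN; set S : R := \sum_(_ <= _ < _) _ => hS.
  have S0 : 0 <= S by exact: sumr_ge0.
  have e2 : e * e <= e by rewrite ler_piMl // ltW.
  have c1 : 1 + e / 4 <= (1 + e) * (1 - e / 8) by move: e0 e1 e2; clear; lra.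
  apply: le_trans (ler_wpM2r S0 c1) _; rewrite -mulrA.
  by apply: ler_wpM2l => //; move: e0; clear; lra.
Qed.

(* The potential at u is the infimum of the lengths of all chains from s to u,
   monotone or not: this is what makes it 1-Lipschitz for |o|. *)
Lemma arc_chain_potential (R : realType) (o : R -> R -> R) (k T : R -> R) (e : R) :
  quasi_additive_arc o k -> dini_gauge k T -> 0 < e -> exists2 d : R, 0 < d &
  forall s t : R, 0 <= s -> s <= t -> t <= 1 -> o s t < d ->
  exists W : R -> R, [/\ continuous W, W s = 0, (1 - e) * o s t <= W t &
    forall u v : R, `|W u - W v| <= `|o u v|].
Proof.
move=> H G e0; have [[ o_diag _ _] _ o_anti _] := H.
pose e' : R := Num.min e 1.
have e'0 : 0 < e' by rewrite lt_min e0 ltr01.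
have [d d0 Td] := tail_small G (ltac:(lra) : 0 < e' / 5).
exists d => // s t s0 st t1 ostd.
pose len (p : nat -> R) n := \sum_(0 <= i < n) `|o (p i) (p i.+1)| : R.
pose lens u := [set x | exists p n, [/\ p 0%N = s, p n = u & x = len p n]].
have len0 p n : 0 <= len p n by exact: sumr_ge0.
have lens_lb u : has_lbound (lens u) by exists 0 => _ [p [n [_ _ ->]]].
have lens_n0 u : lens u !=set0.
  pose p i := if i == 0%N then s else u.
  by exists (len p 1%N), p, 1%N.
pose W u : R := inf (lens u).
have Wle u v : W v <= W u + `|o u v|.
  rewrite -lerBlDr; apply: lb_le_inf => // _ [p [n [p0 pn ->]]].
  rewrite lerBlDr; apply: ge_inf => //.
  (* A chain ending at [u] is prolonged by the point [v]. *)
  exists (fun i => if (i <= n)%N then p i else v), n.+1; split => //.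
    by rewrite ltnn.
  rewrite /len big_nat_recr //= leqnn ltnn pn; congr (_ + _).
  by apply: eq_big_nat => i /andP[_ i_n]; rewrite i_n (ltnW i_n).
have Wlip u v : `|W u - W v| <= `|o u v|.
  rewrite ler_norml; have := Wle u v; have := Wle v u.
  by rewrite (o_anti u v) normrN => h1 h2; apply/andP; split; lra.
exists W; split => //.
- move=> u; apply/cvgrPdist_lt => x x0.
  have : `|o u v| @[v --> u] --> `|o u u|.
    apply: (@continuous_comp _ _ _ (fun v => (u, v)) (fun p : R * R => `|o p.1 p.2|)).
      by apply: (@cvg_pair _ _ _ (nbhs u) (nbhs u) (nbhs u)); [exact: cvg_cst|exact: cvg_id].
    exact: (arc_abs_cont H).
  rewrite o_diag normr0 => /cvgrPdist_lt /(_ x x0); apply: filterS => v.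
  by rewrite sub0r normrN normr_id; apply: le_lt_trans.
- apply/eqP; rewrite eq_le; apply/andP; split.
    by apply: ge_inf => //; exists (fun=> s), 0%N; rewrite /len big_geq.
  by apply: lb_le_inf => // _ [p [n [_ _ ->]]].
- apply: lb_le_inf => // _ [p [n [p0 pn ->]]].
  have ost : 0 <= o s t by exact: (arc_ge0 H).
  apply: (@le_trans _ _ ((1 - e') * o s t)).
    by apply: ler_wpM2r => //; rewrite lerD2l lerN2 ge_min lexx.
  have e'1 : e' <= 1 by rewrite ge_min lexx orbT.
  (* Sewing applies to chains of length at most [d]; a longer one already exceeds [o s t], which is
     below [d]. *)
  have [Sd|dS] := leP (len p n) d; last first.
    apply: le_trans (ltW dS); apply: le_trans (ltW ostd).
    by rewrite ler_piMl //; lra.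
  have := chain_length (arc_qadd H) G Sd (ltac:(lra)); rewrite p0 pn -/(len p n).
  have : `|\sum_(0 <= i < n) o (p i) (p i.+1)| <= len p n by exact: ler_norm_sum.
  move: (len p n) (len0 p n) (\sum_(_ <= _ < _) o _ _) => S S0 X; rewrite !ler_norml.
  move=> /andP[_ XS] /andP[_ hX].
  have h : 5 * T d * S <= e' * S by apply: ler_wpM2r => //; lra.
  (* It remains to use [(1 - e') (1 + e') <= 1], with [e' <= 1] keeping the first factor
     nonnegative. *)
  have {}hX : o s t <= (1 + e') * S by lra.
  have h1 : (1 - e') * o s t <= (1 - e') * ((1 + e') * S).
    by apply: ler_wpM2l; rewrite ?subr_ge0.
  have h2 : 0 <= e' * e' * S by rewrite !mulr_ge0 // ltW.
  by lra.
Qed.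


(** * Hausdorff measure *)

Lemma hrho_ge0 (R : realType) (A : heis R) : 0 <= hrho A.
Proof. by rewrite le_max sqrtr_ge0. Qed.

Lemma hdiam_ge0 (R : realType) (S : set (heis R)) : (0 <= hdiam S)%E.
Proof. by apply: ereal_sup_ubound; left. Qed.

Lemma hdiam_le (R : realType) (S : set (heis R)) (x : R) : 0 <= x ->
  (forall A B, S A -> S B -> hdist A B <= x) -> (hdiam S <= x%:E)%E.
Proof.
move=> x0 h; apply: ge_ereal_sup => _ [->|[[A B] [SA SB] <-]]; rewrite lee_fin //.
exact: h.
Qed.

Lemma hdist_le_hdiam (R : realType) (S : set (heis R)) A B :
  S A -> S B -> ((hdist A B)%:E <= hdiam S)%E.
Proof. by move=> SA SB; apply: ereal_sup_ubound; right; exists (A, B). Qed.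

Lemma hausdorff2_pre_nonincreasing (R : realType) (E : set (heis R)) (a b : R) : a <= b ->
  (hausdorff2_pre b E <= hausdorff2_pre a E)%E.
Proof.
move=> ab; apply: ereal_inf_le_tmp => _ [S [ES Sa] <-]; exists S => //; split => // i.
by apply: le_trans (Sa i) _; rewrite lee_fin.
Qed.

(** The premeasure is nonincreasing in the scale, so its limit at 0 is a supremum and inherits
    bounds that are uniform in the scale. *)
Lemma hausdorff2_bounds (R : realType) (E : set (heis R)) (x y : R) :
  (forall h, 0 < h -> (x%:E <= hausdorff2_pre h E <= y%:E)%E) ->
  (x%:E <= hausdorff2 E <= y%:E)%E.
Proof.
move=> xy; have -> : hausdorff2 E =
    ereal_sup [set hausdorff2_pre h E | h in [set` `]0%R, 1%R[%R]].
  apply/cvg_lim => //; apply: nonincreasing_at_right_cvge; first by rewrite bnd_simp.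
  by move=> a b _ _; exact: hausdorff2_pre_nonincreasing.
apply/andP; split.
  apply: le_ereal_sup_tmp; exists (hausdorff2_pre (1 / 2) E).
    by exists (1 / 2) => //=; rewrite in_itv /=; apply/andP; split; lra.
  by have /andP[] := xy (1 / 2) ltac:(lra).
apply: ge_ereal_sup => _ [h /= + <-]; rewrite in_itv /= => /andP[h0 _].
by have /andP[] := xy h h0.
Qed.

Lemma bounded_diff_sub_itv (R : realType) (E : set R) (l : R) :
  (forall x y, E x -> E y -> `|x - y| <= l) -> exists a, E `<=` `[a, a + l].
Proof.
move=> El; have [->|/set0P E0] := eqVneq E set0; first by exists 0; exact: sub0set.
have lbE y : E y -> lbound E (y - l).
  by move=> Ey z Ez; have := El _ _ Ez Ey; rewrite ler_norml => /andP[h _]; lra.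
exists (inf E) => y Ey /=; rewrite in_itv /=; apply/andP; split.
  by apply: ge_inf => //; exists (y - l); exact: lbE.
by rewrite -lerBlDr; apply: lb_le_inf => //; exact: lbE.
Qed.

(** Countable subadditivity of the Lebesgue measure. *)
Lemma cover_length_ge (R : realType) (x : R) (a l : nat -> R) : 0 <= x ->
  (forall i, 0 <= l i) -> `[0, x] `<=` \bigcup_i `[a i, a i + l i]%classic ->
  (x%:E <= \sum_(0 <= i <oo) (l i)%:E)%E.
Proof.
move=> x0 l0 sub.
have mu_itv (b c : R) : 0 <= c -> lebesgue_measure `[b, b + c]%classic = c%:E.
  move=> c0; rewrite lebesgue_measure_itv /= lte_fin ltrDl.
  have [_|c0'] := ltP 0 c; first by rewrite -EFinD addrC addKr.
  by congr EFin; apply/eqP; rewrite eq_le c0 c0'.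
have -> : x%:E = lebesgue_measure `[0, x]%classic by rewrite -[X in `[_, X]]add0r mu_itv.
have := @measure_sigma_subadditive _ R _ (@lebesgue_measure R) _
  (fun i => `[a i, a i + l i]%classic) _ _ sub.
move=> /(_ (fun=> measurable_itv _) (measurable_itv _)) h; apply: le_trans h _.
by rewrite (eq_eseriesr (fun i _ => mu_itv _ _ (l0 i))).
Qed.

Section ArcMeasure.
Variables (R : realType) (o : R -> R -> R) (k T : R -> R) (g : R -> heis R).
Hypothesis H : quasi_additive_arc o k.
Hypothesis G : dini_gauge k T.
Hypothesis hdist_o : forall s t, hdist (g s) (g t) ^+ 2 = `|o s t|.

(** The covering consists of the pieces of a fine partition. The [L i] bound squared diameters, so
    the partition is taken at scale [h ^+ 2]. *)
Lemma arc_hausdorff2_pre_le (e : R) : 0 < e -> e <= 1 -> exists2 d : R, 0 < d &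
  forall s t : R, 0 <= s -> s <= t -> t <= 1 -> o s t < d -> forall h, 0 < h ->
  (hausdorff2_pre h (g @` `[s, t]) <= ((1 + e) * o s t)%:E)%E.
Proof.
move=> e0 e1; have [d d0 hd] := arc_fine_partition H G e0 e1; exists d => //.
move=> s t s0 st t1 ostd h h0.
have [N [p [L [[N0 p0] pN pL oL sumL]]]] := hd _ _ s0 st t1 ostd (h ^+ 2) (exprn_gt0 _ h0).
pose S i := if (i < N)%N then g @` `[p i, p i.+1] else set0.
have L0 i : (i < N)%N -> 0 <= L i by move=> /pL[_ /andP[]].
have diamS i : (i < N)%N -> (hdiam (S i) <= (Num.sqrt (L i))%:E)%E.
  move=> iN; apply: hdiam_le; first exact: sqrtr_ge0.
  rewrite /S iN => _ _ [u /= u_in <-] [v /= v_in <-].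
  rewrite -[hdist _ _](ger0_norm (hrho_ge0 _)) -sqrtr_sqr ler_wsqrtr // hdist_o.
  by apply: (oL i).
have diamS0 i : (N <= i)%N -> hdiam (S i) = 0%E.
  move=> Ni; apply/eqP; rewrite eq_le hdiam_ge0 andbT; apply: hdiam_le => //.
  by rewrite /S ltnNge Ni.
apply: (@le_trans _ _ (\sum_(0 <= i <oo) hdiam (S i) ^+ 2)%E).
  apply: ereal_inf_lbound; exists S => //; split; last first.
    move=> i; have [iN|Ni] := ltnP i N; last by rewrite diamS0 // lee_fin ltW.
    apply: le_trans (diamS i iN) _; rewrite lee_fin -(ger0_norm (ltW h0)) -sqrtr_sqr.
    by rewrite ler_wsqrtr //; have [_ /andP[]] := pL _ iN.
  move=> _ [u /= + <-]; rewrite in_itv /= => /andP[su ut].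
  have exj : exists j, u <= p j by exists N; rewrite pN.
  (* If [p j] is the first partition point not before [u], then [u] lies in the piece of index
     [j - 1]; [j = 0] means [u = s], which is in the first piece. *)
  case: (ex_minnP exj) => j uj jmin.
  have jN : (j <= N)%N by apply: jmin; rewrite pN.
  case: j => [|j] in uj jmin jN *.
    exists 0%N => //; rewrite /S N0; exists u => //=.
    by rewrite in_itv /= p0 su /= (le_trans uj) // (pL 0%N N0).1.
  exists j => //; rewrite /S jN; exists u => //=; rewrite in_itv /= uj andbT.
  by rewrite leNgt; apply/negP => /ltW /jmin; rewrite ltnn.
rewrite (@nneseries_split _ _ 0 N); last by move=> i _; exact: sqre_ge0.
rewrite add0n eseries0 ?adde0; last by move=> i Ni _; rewrite diamS0 // expe2 mule0.
apply: (@le_trans _ _ (\sum_(0 <= i < N) (L i)%:E)%E); last by rewrite sumEFin lee_fin.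
rewrite big_nat [leRHS]big_nat; apply: lee_sum => i /andP[_ iN].
rewrite -[leRHS]sqr_sqrte ?lee_fin ?L0 //.
by rewrite lee_sqr ?hdiam_ge0 ?lee_fin ?sqrtr_ge0 //; exact: diamS.
Qed.

(** The potential [W] sends the part of the subarc in [S i] into an interval of length
    [hdiam (S i) ^+ 2], and by the intermediate value theorem these intervals cover [[0, W t]]. *)
Lemma arc_hausdorff2_pre_ge (e : R) : 0 < e -> e <= 1 -> exists2 d : R, 0 < d &
  forall s t : R, 0 <= s -> s <= t -> t <= 1 -> o s t < d -> forall h, 0 < h ->
  (((1 - e) * o s t)%:E <= hausdorff2_pre h (g @` `[s, t]))%E.
Proof.
move=> e0 e1; have [d d0 hd] := arc_chain_potential H G e0; exists d => //.
move=> s t s0 st t1 ostd h h0.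
have [W [cW Ws Wt Wo]] := hd s t s0 st t1 ostd.
apply: le_ereal_inf_tmp => _ [S [covS Sh] <-].
have Sfin i : hdiam (S i) \is a fin_num.
  by rewrite ge0_fin_numE ?hdiam_ge0 //; apply: le_lt_trans (Sh i) _; exact: ltry.
pose D i := fine (hdiam (S i)).
have D0 i : 0 <= D i by apply: fine_ge0; exact: hdiam_ge0.
pose E i := [set W u | u in `[s, t] `&` [set u | S i (g u)]].
have /choice [a Ea] : forall i, exists a, E i `<=` `[a, a + D i ^+ 2].
  move=> i; apply: bounded_diff_sub_itv => _ _ [u [_ /= Su] <-] [v [_ /= Sv] <-].
  apply: le_trans (Wo u v) _; rewrite -hdist_o lerXn2r ?nnegrE ?hrho_ge0 //.
  by rewrite -lee_fin fineK //; exact: hdist_le_hdiam.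
have Wt0 : 0 <= W t.
  by apply: le_trans Wt; rewrite mulr_ge0 ?subr_ge0 // (arc_ge0 H).
apply: (@le_trans _ _ (W t)%:E); first by rewrite lee_fin.
have -> : (\sum_(0 <= i <oo) hdiam (S i) ^+ 2 = \sum_(0 <= i <oo) (D i ^+ 2)%:E)%E.
  by apply: eq_eseriesr => i _; rewrite EFin_expe fineK.
apply: (@cover_length_ge _ _ a) => // [i|y /=]; first exact: exprn_ge0.
rewrite in_itv /= => /andP[y0 yt].
have [||u + Wu] := @IVT R W s t y st.
- exact: continuous_subspaceT.
- by rewrite Ws min_l // max_r // y0.
rewrite inE /= => u_in.
have [i _ Siu] := covS (g u) (imageP g u_in).
by exists i => //; apply: Ea; exists u.
Qed.

Lemma arc_hausdorff2 (e : R) : 0 < e -> exists2 d : R, 0 < d &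
  forall s t : R, 0 <= s -> s <= t -> t <= 1 -> o s t < d ->
  (`|hausdorff2 (g @` `[s, t]) - (o s t)%:E| <= (e * o s t)%:E)%E.
Proof.
move=> e0; pose e' : R := Num.min e 1.
have e'0 : 0 < e' by rewrite lt_min e0 ltr01.
have e'1 : e' <= 1 by rewrite ge_min lexx orbT.
have e'e : e' <= e by rewrite ge_min lexx.
have [d1 d10 h1] := arc_hausdorff2_pre_le e'0 e'1.
have [d2 d20 h2] := arc_hausdorff2_pre_ge e'0 e'1.
exists (Num.min d1 d2); first by rewrite lt_min d10.
move=> s t s0 st t1; rewrite lt_min => /andP[lt1 lt2].
have : (((1 - e') * o s t)%:E <= hausdorff2 (g @` `[s, t]) <= ((1 + e') * o s t)%:E)%E.
  by apply: hausdorff2_bounds => h h0; rewrite h1 // h2.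
have ost : 0 <= o s t by exact: (arc_ge0 H).
have eo : e' * o s t <= e * o s t by exact: ler_wpM2r.
case: (hausdorff2 _) => [x| |]; rewrite ?leey_eq ?leeNy_eq ?andbF //.
rewrite !lee_fin ler_norml => /andP[].
by clear -eo => ? ?; apply/andP; split; lra.
Qed.

End ArcMeasure.

(** * Horizontal calculus *)

Section HorizontalCalculus.
Variable R : realType.
Implicit Types A B C : heis R.

(** A one-parameter subgroup for fixed [a], [b]; its left translate by [A] is the flow line of aX +
    bY through [A]. *)
Definition hflow (a b t : R) : heis R := (t * a, t * b, 0).

Lemma hmul_hflow A a b s t :
  hmul (hmul A (hflow a b s)) (hflow a b t) = hmul A (hflow a b (s + t)).
Proof. by rewrite /hmul /hflow /hx /hy /hz /=; congr (_, _, _); ring. Qed.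

Lemma hmul0 A : hmul A 0 = A.
Proof.
case: A => [[x y] z]; rewrite /hmul /hx /hy /hz /=.
by congr (_, _, _); ring.
Qed.

Lemma hflow0 a b : hflow a b 0 = 0.
Proof. by rewrite /hflow !mul0r. Qed.

Section Homogeneous.
Variables (k : nat) (L : heis R -> 'rV[R]_k).
Hypothesis HL : hhom L.

Lemma hhom0 : L 0 = 0.
Proof.
have [_ /(_ 0 0) + _] := HL; rewrite hmul0 => h.
by apply/(addrI (L 0)); rewrite addr0.
Qed.

Lemma hhom_hflow a b t : L (hflow a b t) = t *: L (a, b, 0).
Proof.
have [_ LM Ldil] := HL.
have pos s : 0 < s -> L (hflow a b s) = s *: L (a, b, 0).
  by move=> s0; rewrite -Ldil // /hflow /hdil /hx /hy /hz /= mulr0.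
have [t0|t0|->] := ltgtP t 0; last by rewrite hflow0 hhom0 scale0r.
(* Homogeneity is given for positive factors only; for [t < 0] one uses that [hflow a b t] is the
   inverse of [hflow a b (- t)]. *)
- apply/eqP; rewrite -[t in t *: _]opprK scaleNr -pos ?oppr_gt0 // -addr_eq0 -LM.
  by rewrite -[hflow a b t]hmul0 /hmul /hflow /hx /hy /hz /=; apply/eqP;
     rewrite -[RHS]hhom0; congr L; congr (_, _, _); ring.
- exact: pos.
Qed.

Lemma hhomE B : L B = hx B *: L (1, 0, 0) + hy B *: L (0, 1, 0).
Proof.
have [_ LM _] := HL.
(* A vertical element is a commutator of horizontal ones, so a homomorphism into an abelian group
   kills it. *)
have vert z : L (0, 0, z) = 0.
  pose P := hmul (hflow 1 0 (- z / 4)) (hflow 0 1 1).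
  pose Q := hmul (hflow 1 0 (z / 4)) (hflow 0 1 (- 1)).
  have -> : (0, 0, z) = hmul P Q.
    by rewrite /P /Q /hmul /hflow /hx /hy /hz /=; congr (_, _, _); field.
  rewrite !LM !hhom_hflow mulNr !scaleNr addrACA subrr addNr.
  by rewrite addr0.
have {1}-> : B = hmul (hmul (hflow 1 0 (hx B)) (hflow 0 1 (hy B)))
    (0, 0, hz B + 2 * hx B * hy B).
  by case: B => [[x y] z]; rewrite /hmul /hflow /hx /hy /hz /=; congr (_, _, _); ring.
by rewrite !LM vert addr0 !hhom_hflow.
Qed.

End Homogeneous.

Definition has_hgrad (f gX gY : heis R -> R) : Prop := forall A (a b : R),
  a ^+ 2 + b ^+ 2 <= 1 ->
  is_derive (0 : R) (1 : R) (fun t => f (hmul A (hflow a b t))) (a * gX A + b * gY A).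

(** As [hrho (hflow a b h) <= |h|] for these directions, an error o(hrho) is o(|h|) along the flow
    line. *)
Lemma is_hdiff_derive k (F : heis R -> 'rV[R]_k) A L i (a b : R) :
  is_hdiff F A L -> a ^+ 2 + b ^+ 2 <= 1 ->
  is_derive (0 : R) (1 : R) (fun t => F (hmul A (hflow a b t)) 0 i) (L (a, b, 0) 0 i).
Proof.
move=> [HL /eqoP HF] ab1; set d := L (a, b, 0) 0 i.
suff cv : h^-1 *: (((fun t => F (hmul A (hflow a b t)) 0 i) \o shift 0) (h *: 1)
    - F (hmul A (hflow a b 0)) 0 i) @[h --> (0 : R)^'] --> d.
  by apply: DeriveDef; [exact: cvgP cv|exact: cvg_lim cv].
apply/cvgrPdist_le => e e0.
have flow_cvg : hflow a b h @[h --> (0 : R)] --> (0 : heis R).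
  have lin (c : R) : h * c @[h --> (0 : R)] --> (0 : R).
    by rewrite -[X in _ --> X](mul0r c); apply: cvgM; [exact: cvg_id|exact: cvg_cst].
  apply: (@cvg_pair _ _ _ _ (nbhs ((0, 0) : R * R)) (nbhs (0 : R))).
    by apply: (@cvg_pair _ _ _ _ (nbhs (0 : R)) (nbhs (0 : R))); exact: lin.
  exact: cvg_cst.
have := nbhs_dnbhs (flow_cvg _ (HF e e0)).
apply: filterS2 (nbhs_dnbhs_neq (0 : R)) => h h0 /=.
rewrite hflow0 hmul0 addr0 [h *: 1]mulr1 hhom_hflow //.
set D := F _ - _ - _ => hD.
have hD0 : D 0 i = F (hmul A (hflow a b h)) 0 i - F A 0 i - h * d by rewrite !mxE.
have rho_le : hrho (hflow a b h) <= `|h|.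
  rewrite ge_max /hflow /hx /hy /hz /= normr0 sqrtr0 normr_ge0 andbT -sqrtr_sqr.
  by rewrite ler_wsqrtr // !exprMn -mulrDr ler_piMr // sqr_ge0.
have {}hD : `|D 0 i| <= e * `|h|.
  apply: le_trans (_ : `|D| <= _).
    by rewrite [leRHS]mx_normrE (le_trans _ (le_bigmax _ _ (0, i))).
  apply: le_trans hD _; apply: ler_wpM2l; first exact: ltW.
  by rewrite (ger0_norm (hrho_ge0 _)).
have -> : d - h^-1 *: (F (hmul A (hflow a b h)) 0 i - F A 0 i) = - (h^-1 * D 0 i).
  by rewrite hD0 mulrBr mulKf // opprB.
by rewrite normrN normrM normfV mulrC ler_pdivrMr ?normr_gt0.
Qed.

Lemma hgrad_mvt f gX gY A (a b t : R) : has_hgrad f gX gY -> a ^+ 2 + b ^+ 2 <= 1 ->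
  exists2 s, `|s| <= `|t| & f (hmul A (hflow a b t)) - f A =
    t * (a * gX (hmul A (hflow a b s)) + b * gY (hmul A (hflow a b s))).
Proof.
move=> Hf ab1; pose phi s := f (hmul A (hflow a b s)).
pose dphi s := a * gX (hmul A (hflow a b s)) + b * gY (hmul A (hflow a b s)).
have dphiE s : is_derive s (1 : R) phi (dphi s).
  have [ex val] := Hf (hmul A (hflow a b s)) a b ab1.
  (* By the subgroup law, the difference quotient at time [s] from [A] is the one at time 0 from the
     point reached at time [s]. *)
  have E : (fun h : R => h^-1 *: ((phi \o shift s) (h *: 1) - phi s)) =
    (fun h : R => h^-1 *: (((fun t => f (hmul (hmul A (hflow a b s)) (hflow a b t))) \o shift 0)
      (h *: 1) - f (hmul (hmul A (hflow a b s)) (hflow a b 0)))).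
    by apply/funext => h /=; rewrite !hmul_hflow !addr0 [s + _]addrC.
  by split; [rewrite /derivable E|rewrite /derive E].
have cphi u v : {within `[u, v], continuous phi}.
  by apply: derivable_within_continuous => s _; exact: (@ex_derive _ _ _ _ _ _ _ (dphiE s)).
have phi0 : f A = phi 0 by rewrite /phi hflow0 hmul0.
rewrite phi0 -/(phi t).
have [t0|t0] := leP 0 t.
  have [s] := @MVT_segment R phi dphi 0 t t0 (fun s _ => dphiE s) (cphi _ _).
  rewrite in_itv /= => /andP[s0 st] ->; exists s; first by rewrite !ger0_norm.
  by rewrite subr0 mulrC.
have [s] := @MVT_segment R phi dphi t 0 (ltW t0) (fun s _ => dphiE s) (cphi _ _).
rewrite in_itv /= => /andP[st s0] E; exists s; first by rewrite !ler0_norm ?lerN2 // ltW.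
by rewrite -opprB E sub0r mulrN opprK mulrC.
Qed.

End HorizontalCalculus.

(** * Increments along horizontal polygons *)

Lemma hmulA (R : realType) (A B C : heis R) : hmul A (hmul B C) = hmul (hmul A B) C.
Proof. by rewrite /hmul /hx /hy /hz /=; congr (_, _, _); ring. Qed.

Lemma hdist_mul (R : realType) (A B : heis R) : hdist (hmul A B) A = hrho B.
Proof.
rewrite /hdist hmulA; congr hrho.
by case: A B => [[x y] z] [[x' y'] z']; rewrite /hmul /hinv /hx /hy /hz /=;
   congr (_, _, _); ring.
Qed.

(** Holds at the end of [n] horizontal legs of length at most [d] from 0: the next leg changes the
    height by at most [2 n d^2], which is below [((n + 1)^2 - n^2) d^2]. *)
Definition hbox (R : realType) (d : R) (n : nat) (B : heis R) : Prop :=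
  [/\ `|hx B| <= n%:R * d, `|hy B| <= n%:R * d & `|hz B| <= (n%:R * d) ^+ 2].

Lemma hbox_step (R : realType) (d : R) n (B : heis R) (a b t : R) :
  0 <= d -> `|a| + `|b| <= 1 -> `|t| <= d ->
  hbox d n B -> hbox d n.+1 (hmul B (hflow a b t)).
Proof.
move=> d0 ab td [Bx By Bz].
have nd0 : 0 <= n%:R * d by rewrite mulr_ge0.
have [ta tb] : `|t * a| <= d /\ `|t * b| <= d.
  rewrite !normrM; split; (apply: le_trans td; rewrite ler_piMr //);
  by have := normr_ge0 a; have := normr_ge0 b; lra.
have Ez : hz (hmul B (hflow a b t)) = hz B + (2 * (t * a) * hy B - 2 * hx B * (t * b)).
  by rewrite /hmul /hflow /hx /hy /hz /= addr0 addrA.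
rewrite /hbox Ez -natr1 mulrDl mul1r; split.
- by apply: le_trans (ler_normD _ _) _; exact: lerD.
- by apply: le_trans (ler_normD _ _) _; exact: lerD.
have zb : `|2 * (t * a) * hy B - 2 * hx B * (t * b)| <= 2 * (d * (n%:R * d)).
  apply: le_trans (ler_normB _ _) _; rewrite !normrM ger0_norm //.
  have h1 : `|t| * `|hy B| <= d * (n%:R * d) by exact: ler_pM.
  have h2 : `|t| * `|hx B| <= d * (n%:R * d) by exact: ler_pM.
  have h3 := ler_wpM2r (normr_ge0 a) h1; have h4 := ler_wpM2r (normr_ge0 b) h2.
  have dd : 0 <= d * (n%:R * d) by rewrite mulr_ge0.
  have h5 := ler_wpM2r dd ab.
  by move: h3 h4 h5; clear; lra.
apply: le_trans (ler_normD _ _) _.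
have d2 : 0 <= d ^+ 2 by exact: exprn_ge0.
by move: zb Bz d2; clear; rewrite !expr2; lra.
Qed.

(** 72 is 6^2 + 6^2, for polygons of at most six legs. *)
Lemma hbox_rho (R : realType) (d : R) n (B : heis R) : 0 <= d -> (n <= 6)%N -> hbox d n B ->
  hrho B ^+ 2 <= 72 * d ^+ 2.
Proof.
move=> d0 n6 [Bx By Bz].
have nd : n%:R * d <= 6 * d by rewrite ler_wpM2r // ler_nat.
have sq (x : R) : `|x| <= n%:R * d -> x ^+ 2 <= 36 * d ^+ 2.
  move=> hx; rewrite -real_normK ?num_real //.
  have -> : 36 * d ^+ 2 = (6 * d) ^+ 2 by ring.
  by rewrite lerXn2r ?nnegrE ?mulr_ge0 // (le_trans hx).
have d2 : 0 <= d ^+ 2 by exact: exprn_ge0.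
have le_sqrt : hrho B <= Num.sqrt (72 * d ^+ 2).
  rewrite ge_max; apply/andP; split; rewrite ler_wsqrtr //.
    by have := sq _ Bx; have := sq _ By; lra.
  apply: le_trans Bz _; apply: (@le_trans _ _ ((6 * d) ^+ 2)).
    by rewrite lerXn2r ?nnegrE ?mulr_ge0.
  by rewrite exprMn; lra.
apply: le_trans (_ : Num.sqrt (72 * d ^+ 2) ^+ 2 <= _).
  by rewrite lerXn2r ?nnegrE ?sqrtr_ge0 ?hrho_ge0.
by rewrite sqr_sqrtr ?mulr_ge0.
Qed.

(** Two legs lead to [(x, y, - 2 x y)]; the other four form a commutator, which only adds [- 4 s u]
    to the height. *)
Lemma hflow_hexagon (R : realType) (x y s u : R) :
  hmul (hmul (hmul (hmul (hmul (hmul 0 (hflow 1 0 x)) (hflow 0 1 y))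
    (hflow 1 0 s)) (hflow 0 1 u)) (hflow 1 0 (- s))) (hflow 0 1 (- u)) =
  (x, y, - (2 * x * y) - 4 * (s * u)).
Proof.
have step (P : heis R) (x' y' z a b t : R) : P = (x', y', z) -> hmul P (hflow a b t) =
    (x' + t * a, y' + t * b, z + 2 * (t * a) * y' - 2 * x' * (t * b)).
  by move=> ->; rewrite /hmul /hflow /hx /hy /hz /= addr0.
rewrite (step _ _ _ _ _ _ _ (step _ _ _ _ _ _ _ (step _ _ _ _ _ _ _ (step _ _ _ _ _ _ _
  (step _ _ _ _ _ _ _ (step _ 0 0 0 _ _ _ erefl)))))).
by congr (_, _, _); ring.
Qed.

Section HorizontalIncrement.
Variables (R : realType) (f gX gY : heis R -> R) (m : R -> R).
Implicit Types A B C : heis R.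
Hypothesis f_hgrad : has_hgrad f gX gY.
Hypothesis m_mono : forall s t : R, 0 <= s -> s <= t -> m s <= m t.
Hypothesis gX_mod : forall A B, `|gX A - gX B| <= m (hdist A B ^+ 2).
Hypothesis gY_mod : forall A B, `|gY A - gY B| <= m (hdist A B ^+ 2).

(** [(p, q)] records the horizontal displacement so far, and each of the [n] legs is allowed an
    error [d m(72 d^2)]. *)
Let walk A (d : R) n B (p q : R) : Prop := hbox d n B /\
  `|f (hmul A B) - f A - (p * gX A + q * gY A)| <= n%:R * (d * m (72 * d ^+ 2)).

(** By the mean value theorem the leg sees the gradient at a point whose squared distance from [A]
    is at most [72 d^2]; replacing it by the gradient at [A] costs at most [d m(72 d^2)]. *)
Lemma walk_step A (d : R) n B (p q a b t : R) : 0 <= d -> (n < 6)%N ->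
  `|a| + `|b| <= 1 -> `|t| <= d ->
  walk A d n B p q -> walk A d n.+1 (hmul B (hflow a b t)) (p + t * a) (q + t * b).
Proof.
move=> d0 n6 ab td [box err]; split; first exact: hbox_step.
have ab2 : a ^+ 2 + b ^+ 2 <= 1.
  rewrite -(@real_normK _ a) ?num_real // -(@real_normK _ b) ?num_real //.
  have := normr_ge0 a; have := normr_ge0 b; move: ab.
  move: `|a| `|b| => x y xy y0 x0; have := mulr_ge0 x0 y0.
  have := ler_pM (addr_ge0 x0 y0) (addr_ge0 x0 y0) xy xy.
  by rewrite !expr2; lra.
have [s st E] := @hgrad_mvt _ f gX gY (hmul A B) a b t f_hgrad ab2.
rewrite hmulA.
set P := hmul (hmul A B) (hflow a b s) in E.
have Pd : hdist P A ^+ 2 <= 72 * d ^+ 2.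
  rewrite /P -hmulA hdist_mul; apply: (@hbox_rho _ d n.+1) => //.
  by apply: hbox_step => //; exact: le_trans td.
have M_le : m (hdist P A ^+ 2) <= m (72 * d ^+ 2) by apply: m_mono => //; exact: sqr_ge0.
have eX := le_trans (gX_mod P A) M_le; have eY := le_trans (gY_mod P A) M_le.
move: (m (72 * d ^+ 2)) err eX eY {M_le} => M err eX eY.
have M0 : 0 <= M := le_trans (normr_ge0 _) eX.
have e1 : `|t * (a * (gX P - gX A) + b * (gY P - gY A))| <= d * M.
  rewrite normrM; apply: ler_pM => //.
  apply: le_trans (ler_normD _ _) _; rewrite !normrM.
  apply: le_trans (lerD (ler_wpM2l (normr_ge0 a) eX) (ler_wpM2l (normr_ge0 b) eY)) _.
  by rewrite -mulrDl ler_piMl.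
have -> : f (hmul (hmul A B) (hflow a b t)) - f A -
    ((p + t * a) * gX A + (q + t * b) * gY A) =
  f (hmul A B) - f A - (p * gX A + q * gY A) +
  (f (hmul (hmul A B) (hflow a b t)) - f (hmul A B) - t * (a * gX A + b * gY A)) by ring.
rewrite E -natr1 mulrDl mul1r; apply: le_trans (ler_normD _ _) _; apply: lerD => //.
apply: le_trans e1; rewrite le_eqVlt; apply/orP; left; apply/eqP; congr `|_|; ring.
Qed.

(* B is reached from 0 in six horizontal steps: two to its horizontal part, then
   a commutator of X and Y for the vertical one. *)
Lemma hgrad_increment A B (d : R) : 0 <= d ->
  hx B ^+ 2 + hy B ^+ 2 <= d ^+ 2 -> `|hz B| <= d ^+ 2 ->
  `|f (hmul A B) - f A - (hx B * gX A + hy B * gY A)| <= 6 * (d * m (72 * d ^+ 2)).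
Proof.
move=> d0 Bh Bz.
have sq_le (x y : R) : x ^+ 2 + y ^+ 2 <= d ^+ 2 -> `|x| <= d.
  move=> xy; rewrite -(ger0_norm d0) -!sqrtr_sqr ler_wsqrtr //.
  by apply: le_trans xy; rewrite lerDl sqr_ge0.
have xd := sq_le _ _ Bh; have yd := sq_le (hy B) (hx B); rewrite addrC in Bh.
have {}yd := yd Bh.
pose c := hz B + 2 * hx B * hy B.
have c_le : `|c| <= 2 * d ^+ 2.
  apply: le_trans (ler_normD _ _) _; have -> : 2 * d ^+ 2 = d ^+ 2 + d ^+ 2 by ring.
  apply: lerD => //; apply: le_trans Bh; rewrite ler_norml; apply/andP.
  have := sqr_ge0 (hx B + hy B); have := sqr_ge0 (hx B - hy B).
  by rewrite !expr2 => *; split; lra.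
(* The commutator with legs [d] and [u] must supply the missing height [c], so [- 4 d u = c];
   [|c| <= 2 d^2] keeps [u] within [d]. For [d = 0] both [c] and, as 0 has inverse 0, [u] vanish. *)
pose u := - c / (4 * d).
have du : d * u = - c / 4.
  have [d00|dn0] := eqVneq d 0; last by rewrite /u; field.
  have c0 : c = 0 by apply/eqP; move: c_le; rewrite d00 expr0n mulr0 normr_le0.
  by rewrite c0 d00 mul0r oppr0 mul0r.
have ud : `|u| <= d.
  have [d00|dn0] := eqVneq d 0; first by rewrite /u d00 mulr0 invr0 mulr0 normr0.
  have dp : 0 < d by rewrite lt0r dn0.
  rewrite -(ler_pM2l dp) -{1}(ger0_norm d0) -normrM du normrM normrN -expr2.
  rewrite (ger0_norm (_ : 0 <= 4^-1)) ?invr_ge0 //.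
  by have := sqr_ge0 d; lra.
have a10 : `|1 : R| + `|0 : R| <= 1 by rewrite normr1 normr0 addr0.
have a01 : `|0 : R| + `|1 : R| <= 1 by rewrite normr1 normr0 add0r.
have w0 : walk A d 0 0 0 0.
  by split; rewrite ?hmul0 /hbox /hx /hy /hz /= ?subrr ?normr0 ?mul0r ?expr0n ?addr0 ?subrr ?normr0.
have w6 := walk_step d0 (isT : (5 < 6)%N) a01 (t := - u) (ltac:(by rewrite normrN))
  (walk_step d0 (isT : (4 < 6)%N) a10 (t := - d) (ltac:(by rewrite normrN ger0_norm))
  (walk_step d0 (isT : (3 < 6)%N) a01 ud
  (walk_step d0 (isT : (2 < 6)%N) a10 (t := d) (ltac:(by rewrite ger0_norm))
  (walk_step d0 (isT : (1 < 6)%N) a01 yd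
  (walk_step d0 (isT : (0 < 6)%N) a10 xd w0))))).
case: w6 => _; rewrite hflow_hexagon du !mulr0 !mulr1 !add0r !addr0.
have -> : (hx B, hy B, - (2 * hx B * hy B) - 4 * (- c / 4)) = B.
  rewrite [RHS]surjective_pairing [B.1]surjective_pairing; congr (_, _, _).
  by rewrite /c -/(hz B); field.
have -> : hx B + d - d = hx B by ring.
by have -> : hy B + u - u = hy B by ring.
Qed.

End HorizontalIncrement.

(** * Vertical curves *)

Section VerticalDefect.
Variable R : realType.
Implicit Types A B C : heis R.

Definition hvert A B : R := hz (hmul (hinv A) B).

Lemma hvertE A B :
  hvert A B = hz B - hz A - 2 * hx B * hy A + 2 * hx A * hy B.
Proof. by rewrite /hvert /hmul /hinv /hx /hy /hz /=; ring. Qed.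

Lemma hvert_anti A B : hvert B A = - hvert A B.
Proof. by rewrite !hvertE; ring. Qed.

Lemma hvert_diag A : hvert A A = 0.
Proof. by rewrite hvertE; ring. Qed.

Lemma hmulKV A B : hmul A (hmul (hinv A) B) = B.
Proof.
by case: A B => [[x y] z] [[x' y'] z']; rewrite /hmul /hinv /hx /hy /hz /=;
   congr (_, _, _); ring.
Qed.

Lemma hdistxx A : hdist A A = 0.
Proof.
have -> : hdist A A = hrho (0 : heis R).
  congr hrho; case: A => [[x y] z]; rewrite /hmul /hinv /hx /hy /hz /=.
  by congr (_, _, _); ring.
by rewrite /hrho /hx /hy /hz /= normr0 expr0n /= addr0 sqrtr0 maxxx.
Qed.

Lemma hor_le_hrho A : hx A ^+ 2 + hy A ^+ 2 <= hrho A ^+ 2.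
Proof.
rewrite -[leLHS]sqr_sqrtr ?addr_ge0 ?sqr_ge0 //.
by rewrite lerXn2r ?nnegrE ?sqrtr_ge0 ?hrho_ge0 // le_max lexx.
Qed.

Lemma vert_le_hrho A : `|hz A| <= hrho A ^+ 2.
Proof.
rewrite -[leLHS]sqr_sqrtr //.
by rewrite lerXn2r ?nnegrE ?sqrtr_ge0 ?hrho_ge0 // le_max lexx orbT.
Qed.

Lemma hdist0_eq A B : hdist A B = 0 -> A = B.
Proof.
move=> AB0; have := hor_le_hrho (hmul (hinv B) A); have := vert_le_hrho (hmul (hinv B) A).
rewrite -/(hdist A B) AB0 expr0n /= normr_le0 => /eqP z0.
have x0 := sqr_ge0 (hx (hmul (hinv B) A)); have y0 := sqr_ge0 (hy (hmul (hinv B) A)).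
move=> xy.
have /eqP : hx (hmul (hinv B) A) ^+ 2 = 0 by lra.
have /eqP : hy (hmul (hinv B) A) ^+ 2 = 0 by lra.
rewrite !sqrf_eq0 => /eqP + /eqP; move: z0; case: A B {AB0 x0 y0 xy} => [[x y] z] [[x' y'] z'].
rewrite /hmul /hinv /hx /hy /hz /= => hz0 hy0 hx0.
have ex : x = x' by lra.
have ey : y = y' by lra.
by rewrite ex ey in hz0 *; congr (_, _, _); lra.
Qed.

Lemma hvert_add A B C : hvert A C - hvert A B - hvert B C =
  2 * (hx (hmul (hinv B) A) * hy (hmul (hinv B) C) -
       hy (hmul (hinv B) A) * hx (hmul (hinv B) C)).
Proof. by rewrite !hvertE /hmul /hinv /hx /hy /hz /=; ring. Qed.

(** Twice the area is at most the sum of the squared lengths of the two horizontal parts, hence at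
    most the sum of the two squared distances. *)
Lemma hvert_quasi A B C :
  hdist A B ^+ 2 = `|hvert A B| -> hdist C B ^+ 2 = `|hvert B C| ->
  `|hvert A C| <= 2 * (`|hvert A B| + `|hvert B C|).
Proof.
move=> hAB hBC.
have := hor_le_hrho (hmul (hinv B) A); rewrite -/(hdist A B) hAB.
have := hor_le_hrho (hmul (hinv B) C); rewrite -/(hdist C B) hBC.
have := hvert_add A B C.
move: (hx _) (hy _) (hx _) (hy _) => x2 y1 x1 y2 E h2 h1.
have {E} -> : hvert A C = hvert A B + hvert B C + 2 * (x1 * y2 - y1 * x2) by lra.
apply: le_trans (ler_normD _ _) _.
have n1 := ler_normD (hvert A B) (hvert B C).
suff : `|2 * (x1 * y2 - y1 * x2)| <= `|hvert A B| + `|hvert B C| by lra.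
apply: le_trans (lerD h1 h2); rewrite ler_norml; apply/andP.
have := sqr_ge0 (x1 + y2); have := sqr_ge0 (x1 - y2).
have := sqr_ge0 (y1 + x2); have := sqr_ge0 (y1 - x2).
by clear; rewrite !expr2 => *; split; lra.
Qed.

End VerticalDefect.

(* For a unit vector n and its rotation n', u /\ v = (u.n)(v.n') - (v.n)(u.n'). *)
Lemma area_le (R : realFieldType) (a b x1 y1 x2 y2 d M : R) : 0 <= d ->
  `|x1| <= d -> `|y1| <= d -> `|x2| <= d -> `|y2| <= d ->
  `|a * x1 + b * y1| <= M -> `|a * x2 + b * y2| <= M ->
  (`|a| + `|b|) * `|x1 * y2 - y1 * x2| <= 4 * (d * M).
Proof.
move=> d0 x1d y1d x2d y2d h1 h2; have M0 : 0 <= M := le_trans (normr_ge0 _) h1.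
set s := `|a| + `|b|; have s0 : 0 <= s by exact: addr_ge0.
have [->|sn0] := eqVneq s 0; first by rewrite mul0r !mulr_ge0.
have sp : 0 < s by rewrite lt0r sn0.
have cross (x y : R) : `|x| <= d -> `|y| <= d -> `|a * y - b * x| <= s * d.
  move=> xd yd; apply: le_trans (ler_normB _ _) _; rewrite !normrM mulrDl.
  by apply: lerD; exact: ler_wpM2l.
have n2 : s ^+ 2 <= 2 * (a ^+ 2 + b ^+ 2).
  rewrite -(@real_normK _ a) ?num_real // -(@real_normK _ b) ?num_real // /s.
  by have := sqr_ge0 (`|a| - `|b|); clear; rewrite !expr2; lra.
have key : (a ^+ 2 + b ^+ 2) * `|x1 * y2 - y1 * x2| <= 2 * (s * (d * M)).
  have {1}-> : a ^+ 2 + b ^+ 2 = `|a ^+ 2 + b ^+ 2| by rewrite ger0_norm // addr_ge0 ?sqr_ge0.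
  rewrite -normrM.
  have -> : (a ^+ 2 + b ^+ 2) * (x1 * y2 - y1 * x2) =
    (a * x1 + b * y1) * (a * y2 - b * x2) - (a * x2 + b * y2) * (a * y1 - b * x1) by ring.
  apply: le_trans (ler_normB _ _) _; rewrite !normrM.
  have := ler_pM (normr_ge0 _) (normr_ge0 _) h1 (cross _ _ x2d y2d).
  have := ler_pM (normr_ge0 _) (normr_ge0 _) h2 (cross _ _ x1d y1d).
  by clear; lra.
have h : s ^+ 2 * `|x1 * y2 - y1 * x2| <= 4 * (s * (d * M)).
  by have := ler_wpM2r (normr_ge0 (x1 * y2 - y1 * x2)) n2; move: key; clear; lra.
by rewrite -(ler_pM2l sp); move: h; clear; rewrite expr2; lra.
Qed.

Section Gauge.
Variables (R : realType) (f gX gY : heis R -> R) (m : R -> R).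
Implicit Types A B C : heis R.
Hypothesis f_hgrad : has_hgrad f gX gY.
Hypothesis m_mono : forall s t : R, 0 <= s -> s <= t -> m s <= m t.
Hypothesis gX_mod : forall A B, `|gX A - gX B| <= m (hdist A B ^+ 2).
Hypothesis gY_mod : forall A B, `|gY A - gY B| <= m (hdist A B ^+ 2).

(** [hgrad_increment] with [d] the square root of [w]: as [f] does not change, the linear term is
    bounded by the error. *)
Lemma hgrad_level A B (w : R) : f A = f B -> hdist B A ^+ 2 = `|hvert A B| ->
  `|hvert A B| <= w ->
  [/\ `|hx (hmul (hinv A) B)| <= Num.sqrt w, `|hy (hmul (hinv A) B)| <= Num.sqrt w &
  `|gX A * hx (hmul (hinv A) B) + gY A * hy (hmul (hinv A) B)| <=
    6 * (Num.sqrt w * m (72 * w))].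
Proof.
move=> fAB AB ABw; have w0 : 0 <= w := le_trans (normr_ge0 _) ABw.
have hor : hx (hmul (hinv A) B) ^+ 2 + hy (hmul (hinv A) B) ^+ 2 <= w.
  by apply: le_trans (hor_le_hrho _) _; rewrite -/(hdist B A) AB.
have x0 := sqr_ge0 (hx (hmul (hinv A) B)); have y0 := sqr_ge0 (hy (hmul (hinv A) B)).
split; first by rewrite -sqrtr_sqr ler_wsqrtr //; lra.
  by rewrite -sqrtr_sqr ler_wsqrtr //; lra.
have := hgrad_increment f_hgrad m_mono gX_mod gY_mod A (B := hmul (hinv A) B)
  (sqrtr_ge0 w).
rewrite sqr_sqrtr // => /(_ hor ABw); rewrite hmulKV fAB subrr sub0r normrN.
by rewrite ![_ * gX _]mulrC ![_ * gY _]mulrC.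
Qed.

(** 48 = 2 * 4 * 6 comes from doubling the area, from [area_le] and from the six legs; the division
    by [c] uses the lower bound on the gradient at the middle point [B]. *)
Lemma hvert_defect A B C (c w : R) : 0 < c -> c <= `|gX B| + `|gY B| ->
  f A = f B -> f C = f B ->
  hdist A B ^+ 2 = `|hvert A B| -> hdist C B ^+ 2 = `|hvert B C| ->
  `|hvert A B| <= w -> `|hvert B C| <= w ->
  `|hvert A C - hvert A B - hvert B C| <= w * (48 / c * m (72 * w)).
Proof.
move=> c0 cB fA fC hAB hBC ABw BCw; have w0 : 0 <= w := le_trans (normr_ge0 _) ABw.
rewrite (hvert_anti B A) normrN in hAB ABw.
have [x1 y1 l1] := hgrad_level (esym fA) hAB ABw.
have [x2 y2 l2] := hgrad_level (esym fC) hBC BCw.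
have := area_le (sqrtr_ge0 w) x1 y1 x2 y2 l1 l2.
rewrite hvert_add normrM (ger0_norm (_ : 0 <= 2)) //.
set X : R := `|_ * _ - _ * _|; have X0 : 0 <= X by exact: normr_ge0.
have -> : 4 * (Num.sqrt w * (6 * (Num.sqrt w * m (72 * w)))) = 24 * w * m (72 * w).
  transitivity (24 * Num.sqrt w ^+ 2 * m (72 * w)); first ring.
  by rewrite sqr_sqrtr.
have := ler_wpM2r X0 cB => h1 h2.
have -> : w * (48 / c * m (72 * w)) = 2 * (24 * w * m (72 * w)) / c.
  by field; rewrite gt_eqF.
by rewrite ler_pdivlMr //; lra.
Qed.
End Gauge.

(** * Reduction to a nondecreasing modulus *)

Lemma antitone_summable_le0 (R : realType) (m : R -> R) (r t : R) :
  (forall s t : R, 0 <= s -> s <= t -> m t <= m s) -> 1 < r ->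
  cvgn (series (fun k : nat => m (r ^- k))) -> 0 < t -> m t <= 0.
Proof.
move=> m_anti r1 /cvg_series_cvg_0 m0 t0; rewrite leNgt; apply/negP => mt.
have r0 : 0 < r by exact: lt_trans r1.
have [n rn] := exprn_unbounded t^-1 r1.
have /cvgrPdist_lt /(_ _ mt) [N _ /(_ (N + n)%N (leq_addr _ _))] := m0.
rewrite sub0r normrN => h.
have : m t <= m (r ^- (N + n)).
  apply: m_anti; first by rewrite invr_ge0 exprn_ge0 // ltW.
  rewrite -[leRHS]invrK lef_pV2 ?posrE ?exprn_gt0 ?invr_gt0 // (le_trans rn) //.
  by rewrite ler_eXn2l // leq_addl.
by move=> /(le_trans) /(_ (ler_norm _)); rewrite leNgt h.
Qed.

(** A nonincreasing summable modulus is at most 0 at positive arguments, so it forces [gX] and [gY]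
    to be constant and the zero modulus serves instead. *)
Lemma dini_modulus_nondecreasing (R : realType) (m : R -> R) (r : R) (gX gY : heis R -> R) :
  (forall t : R, 0 <= t -> 0 <= m t) ->
  (forall s t : R, 0 <= s -> s <= t -> m s <= m t) \/
  (forall s t : R, 0 <= s -> s <= t -> m t <= m s) ->
  1 < r -> cvgn (series (fun k : nat => m (r ^- k))) ->
  (forall A B, `|gX A - gX B| <= m (hdist A B ^+ 2)) ->
  (forall A B, `|gY A - gY B| <= m (hdist A B ^+ 2)) ->
  exists m' : R -> R, [/\ forall t : R, 0 <= t -> 0 <= m' t,
    forall s t : R, 0 <= s -> s <= t -> m' s <= m' t,
    cvgn (series (fun k : nat => m' (r ^- k))),
    forall A B, `|gX A - gX B| <= m' (hdist A B ^+ 2) &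
    forall A B, `|gY A - gY B| <= m' (hdist A B ^+ 2)].
Proof.
move=> m0 [m_mono|m_anti] r1 m_sum hX hY; first by exists m.
have van (g : heis R -> R) A B : (forall A B, `|g A - g B| <= m (hdist A B ^+ 2)) ->
    `|g A - g B| <= 0.
  move=> hg; have [AB0|AB] := eqVneq (hdist A B) 0.
    by rewrite (hdist0_eq AB0) subrr normr0.
  apply: le_trans (hg A B) (antitone_summable_le0 m_anti r1 m_sum _).
  by rewrite exprn_gt0 // lt0r AB hrho_ge0.
exists (fun=> 0); split => // [|A B|A B]; [|exact: van|exact: van].
have -> : series (fun=> 0 : R) = fun=> 0.
  by apply/funext => n; rewrite /series /= big1.
exact: is_cvg_cst.
Qed.

(** * The horizontal gradient of a map of class C^1_H *)

Section C1HGradient.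
Variables (R : realType) (k : nat) (F : heis R -> 'rV[R]_k).
Hypothesis F_C1H : C1H F.

Lemma C1H_Dh A : is_hdiff F A (Dh F A).
Proof. exact: (xgetPex (fun=> 0) (F_C1H.1 A)). Qed.

Lemma C1H_has_hgrad i : has_hgrad (fun A => F A 0 i)
  (fun A => Dh F A (1, 0, 0) 0 i) (fun A => Dh F A (0, 1, 0) 0 i).
Proof.
move=> A a b ab; have HL := C1H_Dh A.
have := is_hdiff_derive i HL ab; congr is_derive.
by rewrite (hhomE HL.1) !mxE /hx /hy.
Qed.

Lemma C1H_hX i A : hX (fun A => F A 0 i) A = Dh F A (1, 0, 0) 0 i.
Proof.
have := @C1H_has_hgrad i A 1 0; rewrite expr1n expr0n addr0 lexx => /(_ isT) D.
rewrite /hX derive1E.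
have -> : (fun t : R => F (hmul A (t, 0, 0)) 0 i) = (fun t => F (hmul A (hflow 1 0 t)) 0 i).
  by apply/funext => t; rewrite /hflow mulr1 mulr0.
by rewrite (@derive_val _ _ _ _ _ _ _ D) mul1r mul0r addr0.
Qed.

Lemma C1H_hY i A : hY (fun A => F A 0 i) A = Dh F A (0, 1, 0) 0 i.
Proof.
have := @C1H_has_hgrad i A 0 1; rewrite expr1n expr0n add0r lexx => /(_ isT) D.
rewrite /hY derive1E.
have -> : (fun t : R => F (hmul A (0, t, 0)) 0 i) = (fun t => F (hmul A (hflow 0 1 t)) 0 i).
  by apply/funext => t; rewrite /hflow mulr1 mulr0.
by rewrite (@derive_val _ _ _ _ _ _ _ D) mul1r mul0r add0r.
Qed.

Lemma C1H_Dh_cont i B : hrho B <= 1 -> continuous (fun A => Dh F A B 0 i).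
Proof.
move=> B1 A; apply/cvgrPdist_le => e e0.
apply: filterS (F_C1H.2 A e e0) => A' /(_ B) h; rewrite distrC.
have -> : Dh F A' B 0 i - Dh F A B 0 i = (Dh F A' B - Dh F A B) 0 i by rewrite !mxE.
apply: (@le_trans _ _ (e * hrho B)); last by rewrite ler_piMr // ltW.
by apply: le_trans h; rewrite [leRHS]mx_normrE (le_trans _ (le_bigmax _ _ (0, i))).
Qed.

(** Otherwise the [i]-th component of the differential would vanish identically by [hhomE], and the
    all-ones vector would not be a value. *)
Lemma C1H_surj_neq0 i A : set_surj setT setT (Dh F A) ->
  0 < `|Dh F A (1, 0, 0) 0 i| + `|Dh F A (0, 1, 0) 0 i|.
Proof.
move=> /(_ (const_mx 1) I) [B _]; rewrite (hhomE (C1H_Dh A).1) => /matrixP /(_ 0 i).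
rewrite !mxE => E; rewrite lt0r addr_ge0 // andbT; apply/eqP => /eqP.
rewrite paddr_eq0 // !normr_eq0 => /andP[/eqP x0 /eqP y0]; move: E.
by rewrite x0 y0 !mulr0 addr0 => /eqP; rewrite eq_sym oner_eq0.
Qed.

End C1HGradient.

(** * Orientation and subarcs of a simple arc *)

Section Arcs.
Variable R : realType.

(** The retraction of the line onto [0, 1], used to extend an arc by constants to a curve continuous
    on the whole line. *)
Definition clamp (t : R) : R := Num.max 0 (Num.min t 1).

Lemma clamp_itv t : 0 <= clamp t <= 1.
Proof. by rewrite le_max lexx ge_max ler01 ge_min lexx orbT. Qed.

Lemma clamp_id t : 0 <= t <= 1 -> clamp t = t.
Proof. by move=> /andP[t0 t1]; rewrite /clamp min_l // max_r. Qed.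

Lemma clamp_cont : continuous clamp.
Proof.
move=> t; apply: (@continuous_max R R (fun=> 0) (fun t => Num.min t 1)).
  exact: cvg_cst.
by apply: (@continuous_min R R id (fun=> 1)); [exact: cvg_id|exact: cvg_cst].
Qed.

Lemma arc_clamp_cont (gamma : R -> heis R) : {within `[0, 1], continuous gamma} ->
  continuous (gamma \o clamp).
Proof.
move=> /subspace_continuousP gc t.
have ct : `[0, 1]%classic (clamp t) by rewrite /= in_itv clamp_itv.
apply: cvg_trans (gc _ ct) => P /= gP.
have cP : nbhs t (clamp @^-1` [set s | `[0, 1]%classic s -> P (gamma s)]) := clamp_cont gP.
suff : nbhs t ((gamma \o clamp) @^-1` P) by [].
apply: filterS cP => s; apply.
by rewrite /= in_itv /= clamp_itv.
Qed.

Lemma hvert_cont (g : R -> heis R) : continuous g ->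
  continuous (fun p : R * R => hvert (g p.1) (g p.2)).
Proof.
move=> cg.
have -> : (fun p : R * R => hvert (g p.1) (g p.2)) = (fun p => hz (g p.2) - hz (g p.1) -
    2 * hx (g p.2) * hy (g p.1) + 2 * hx (g p.1) * hy (g p.2)).
  by apply/funext => p; rewrite hvertE.
move=> p; have cfst (U V : topologicalType) (q : U * V) : q'.1 @[q' --> q] --> q.1 by exact: cvg_fst.
have csnd (U V : topologicalType) (q : U * V) : q'.2 @[q' --> q] --> q.2 by exact: cvg_snd.
have c1 : g q.1 @[q --> p] --> g p.1 by exact: (cvg_comp _ _ (cfst _ _ p) (cg _)).
have c2 : g q.2 @[q --> p] --> g p.2 by exact: (cvg_comp _ _ (csnd _ _ p) (cg _)).
have pr (h : R * R -> heis R) : h q @[q --> p] --> h p ->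
    [/\ hx (h q) @[q --> p] --> hx (h p), hy (h q) @[q --> p] --> hy (h p) &
        hz (h q) @[q --> p] --> hz (h p)].
  move=> ch; split; [exact: (cvg_comp _ _ (cvg_comp _ _ ch (cfst _ _ _)) (cfst _ _ _))
    |exact: (cvg_comp _ _ (cvg_comp _ _ ch (cfst _ _ _)) (csnd _ _ _))
    |exact: (cvg_comp _ _ ch (csnd _ _ _))].
have [x1 y1 z1] := pr _ c1; have [x2 y2 z2] := pr _ c2.
by apply: cvgD; [apply: cvgB; [exact: cvgB|]|];
  apply: cvgM => //; apply: cvgM => //; exact: cvg_cst.
Qed.

(* The segment from (0, 1) to (s, t) stays inside the triangle. *)
Lemma triangle_sign (w : R * R -> R) : continuous w ->
  (forall s t, 0 <= s -> s < t -> t <= 1 -> w (s, t) != 0) ->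
  exists2 e : R, `|e| = 1 & forall s t, 0 <= s -> s < t -> t <= 1 -> 0 < e * w (s, t).
Proof.
move=> cw wn0; exists (Num.sg (w (0, 1))); first by rewrite normr_sg wn0.
move=> s t s0 st t1; rewrite ltNge; apply/negP => neg.
pose c (u : R) := (u * s, 1 - u * (1 - t)).
have cc : continuous c.
  move=> u; apply: (@cvg_pair _ _ _ _ (nbhs (u * s)) (nbhs (1 - u * (1 - t)))).
    by apply: cvgM; [exact: cvg_id|exact: cvg_cst].
  by apply: cvgB; [exact: cvg_cst|apply: cvgM; [exact: cvg_id|exact: cvg_cst]].
have cwc : continuous (w \o c) by move=> u; exact: (cvg_comp _ _ (cc u) (cw _)).
have w0 : w (c 0) = w (0, 1) by rewrite /c !mul0r subr0.
have w1 : w (c 1) = w (s, t) by rewrite /c !mul1r subKr.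
have [||u u01 /= wu] := @IVT R (w \o c) 0 1 0 ler01.
- exact: continuous_subspaceT.
- rewrite /= w0 w1 ge_min le_max; have := wn0 0 1 (lexx _) ltr01 (lexx _).
  case: (ltgtP 0 (w (0, 1))) => // h _; move: neg; [rewrite gtr0_sg //|rewrite ltr0_sg //].
    by rewrite mul1r => ->; rewrite orbT.
  by rewrite mulN1r oppr_le0 => ->; rewrite orbT.
move: u01; rewrite in_itv /= => /andP[u0 u1].
suff : w (c u) != 0 by rewrite wu eqxx.
have a1 : 0 <= (1 - u) * 1 by rewrite mulr1 subr_ge0.
have us : 0 <= u * s by rewrite mulr_ge0.
have ut : 0 <= u * (1 - t) by rewrite mulr_ge0 // subr_ge0.
apply: wn0 => //; last by rewrite gerBl.
have [->|un0] := eqVneq u 0; first by rewrite !mul0r subr0.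
have : 0 < u * (t - s) by rewrite mulr_gt0 ?subr_gt0 // lt0r un0.
by lra.
Qed.

End Arcs.

Section VerticalArc.
Variables (R : realType) (Gamma : set (heis R)).
Hypothesis Gamma_vert : forall A B, Gamma A -> Gamma B -> A <> B ->
  hdist A B ^+ 2 = `|hvert A B| /\ 0 < `|hvert A B|.

Lemma vert_hdist A B : Gamma A -> Gamma B -> hdist A B ^+ 2 = `|hvert A B|.
Proof.
move=> GA GB; have [->|/eqP AB] := eqVneq A B; last by have [] := Gamma_vert GA GB AB.
by rewrite hdistxx hvert_diag normr0 expr0n.
Qed.

Lemma arc_param_mem gamma (t : R) : arc_param gamma Gamma -> 0 <= t <= 1 -> Gamma (gamma t).
Proof. by move=> [_ _ <-] t01; exists t => //=; rewrite in_itv. Qed.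

(** By injectivity of [gamma], w has no zero on the connected triangle [s < t]; [e] is the
    orientation of [gamma]. *)
Lemma vert_arc_sign gamma : arc_param gamma Gamma -> exists2 e : R, `|e| = 1 &
  forall s t : R, 0 <= s -> s < t -> t <= 1 -> 0 < e * hvert (gamma s) (gamma t).
Proof.
move=> Hg; have [cg injg _] := Hg; have cgc := arc_clamp_cont cg.
have [|e e1 he] := triangle_sign (hvert_cont cgc).
  move=> s t s0 st t1 /=; rewrite -normr_gt0.
  have s01 : 0 <= s <= 1 by rewrite s0 (le_trans (ltW st)).
  have t01 : 0 <= t <= 1 by rewrite t1 (le_trans s0 (ltW st)).
  rewrite !clamp_id //.
  have neq : gamma s <> gamma t.
    move=> E; have := injg s t; rewrite !inE /= !in_itv /= => /(_ s01 t01 E) st'.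
    by rewrite st' ltxx in st.
  by have [] := Gamma_vert (arc_param_mem Hg s01) (arc_param_mem Hg t01) neq.
exists e => // s t s0 st t1; have := he s t s0 st t1; rewrite /= !clamp_id //.
  by rewrite t1 (le_trans s0 (ltW st)).
by rewrite s0 (le_trans (ltW st)).
Qed.

(** The left-hand side involves only the three points of the curve, so being between does not depend
    on the parametrization. *)
Lemma vert_arc_between gamma (s t u : R) : arc_param gamma Gamma ->
  0 <= s <= 1 -> 0 <= t <= 1 -> 0 <= u <= 1 ->
  (0 <= hvert (gamma s) (gamma u) * hvert (gamma u) (gamma t)) =
  (Num.min s t <= u <= Num.max s t).
Proof.
move=> Hg; have [e e1 he] := vert_arc_sign Hg.
have ee : e * e = 1.
  by have := real_normK (num_real e); rewrite e1 expr1n expr2.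
wlog st : s t / s <= t.
  move=> hw s01 t01 u01; have [st|ts] := orP (le_total s t); first exact: hw.
  rewrite minC maxC -hw // (hvert_anti (gamma u) (gamma s)) (hvert_anti (gamma t) (gamma u)).
  by rewrite mulrNN mulrC.
move=> /andP[s0 s1] /andP[t0 t1] /andP[u0 u1].
rewrite (min_l st) (max_r st).
have -> : hvert (gamma s) (gamma u) * hvert (gamma u) (gamma t) =
    (e * hvert (gamma s) (gamma u)) * (e * hvert (gamma u) (gamma t)).
  by rewrite mulrACA ee mul1r.
have neg a b : 0 <= b -> b < a -> a <= 1 -> e * hvert (gamma a) (gamma b) < 0.
  by move=> b0 ba a1; rewrite hvert_anti mulrN oppr_lt0; exact: he.
have ge0 a b : 0 <= a -> a <= b -> b <= 1 -> 0 <= e * hvert (gamma a) (gamma b).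
  move=> a0; rewrite le_eqVlt => /predU1P[<- _|ab b1]; first by rewrite hvert_diag mulr0.
  by rewrite ltW // he.
have [su|us] := leP s u; last first.
  by rewrite leNgt nmulr_rlt0 ?neg ?he // (lt_le_trans us).
have [ut|tu] := leP u t; first by rewrite mulr_ge0 // ge0.
by rewrite leNgt pmulr_rlt0 ?neg ?he // (le_lt_trans st).
Qed.

(** [subarc] ranges over all parametrizations; by [vert_arc_between] each of them gives the same
    points as [gamma]. *)
Lemma vert_subarcE gamma (s t : R) : arc_param gamma Gamma -> 0 <= s <= 1 -> 0 <= t <= 1 ->
  subarc Gamma (gamma s) (gamma t) = gamma @` `[Num.min s t, Num.max s t].
Proof.
move=> Hg s01 t01; apply/seteqP; split => P.
  move=> [g' [s' [t' [u' [Hg' [s'01 Es] [t'01 Et] [u'01 Eu]]]]]].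
  rewrite !in_itv /= in s'01 t'01 u'01.
  have u'1 : 0 <= u' <= 1.
    have /andP[h1 h2] := u'01; have /andP[s'0 s'1] := s'01; have /andP[t'0 t'1] := t'01.
    by rewrite (le_trans _ h1) ?le_min ?s'0 // (le_trans h2) // ge_max s'1.
  have : Gamma P by rewrite -Eu; exact: arc_param_mem.
  have [_ _ {1}<-] := Hg => -[u /=]; rewrite in_itv /= => u01 Pu.
  exists u => //=; rewrite in_itv /= -(vert_arc_between Hg) // Pu -Es -Et -Eu.
  by rewrite (vert_arc_between Hg').
move=> [u /=]; rewrite in_itv /= => u_in Pu.
by exists gamma, s, t, u; split; rewrite // in_itv.
Qed.

End VerticalArc.

(** * Strong Ahlfors regularity of vertical curves *)

Theorem mainTheorem11 (R : realType) (F : heis R -> 'rV[R]_2)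
    (m : R -> R) (r : R) (Gamma : set (heis R))
    (F_C1H : C1H F) (F0 : F 0 = 0) (DhF0_surj : set_surj setT setT (Dh F 0))
    (m_ge0 : forall t : R, 0 <= t -> 0 <= m t)
    (m_mono : (forall s t : R, 0 <= s -> s <= t -> m s <= m t) \/
              (forall s t : R, 0 <= s -> s <= t -> m t <= m s))
    (r_gt1 : 1 < r)
    (m_sum : cvgn (series (fun k : nat => m (r ^- k))))
    (f_mod : let f := fun A => F A 0 0 in forall A B : heis R,
       Num.max `|hX f A - hX f B| `|hY f A - hY f B| <= m (hdist A B ^+ 2))
    (Gamma_vert : vertical_curve F Gamma) :
  strongly_ahlfors_regular Gamma.
Proof.
have [_ _ _ [U [_ GammaU U_surj [gamma Hg] Gv]]] := Gamma_vert.
have {}Gv A B : Gamma A -> Gamma B -> A <> B ->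
    hdist A B ^+ 2 = `|hvert A B| /\ 0 < `|hvert A B| := @Gv A B.
pose gX A : R := Dh F A (1, 0, 0) 0 0; pose gY A : R := Dh F A (0, 1, 0) 0 0.
have gX_mod0 A B : `|gX A - gX B| <= m (hdist A B ^+ 2).
  by apply: le_trans (f_mod A B); rewrite le_max !(C1H_hX F_C1H) lexx.
have gY_mod0 A B : `|gY A - gY B| <= m (hdist A B ^+ 2).
  by apply: le_trans (f_mod A B); rewrite le_max !(C1H_hY F_C1H) lexx orbT.
have [m' [m'_ge0 m'_mono m'_sum gX_mod gY_mod]] :=
  dini_modulus_nondecreasing m_ge0 m_mono r_gt1 m_sum gX_mod0 gY_mod0.
have f_hgrad : has_hgrad (fun A => F A 0 0) gX gY := C1H_has_hgrad F_C1H 0.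
have [cg _ imgE] := Hg.
pose g := gamma \o @clamp R; have g_cont : continuous g := arc_clamp_cont cg.
have Gg t : Gamma (g t) by apply: (arc_param_mem Hg); exact: clamp_itv.
have GF A : Gamma A -> F A = 0 by rewrite GammaU => -[].
have GU A : Gamma A -> U A by rewrite GammaU => -[].
(* The gradient of [f] is continuous and, by surjectivity of the differential on [U], nonzero along
   the compact arc. *)
have [c c0 c_le] : exists2 c, 0 < c & forall t, c <= `|gX (g t)| + `|gY (g t)|.
  pose G t := `|gX (g t)| + `|gY (g t)|.
  have unit_rho (B : heis R) : B = (1, 0, 0) \/ B = (0, 1, 0) -> hrho B <= 1.
    by case=> ->; rewrite /hrho /hx /hy /hz /= ?expr1n ?expr0n /= ?addr0 ?add0r
      normr0 sqrtr0 sqrtr1 ge_max lexx ler01.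
  have gX_cont : continuous gX by apply: (C1H_Dh_cont F_C1H); apply: unit_rho; left.
  have gY_cont : continuous gY by apply: (C1H_Dh_cont F_C1H); apply: unit_rho; right.
  have G_cont : continuous G.
    move=> t; apply: cvgD; apply: cvg_norm.
      exact: (cvg_comp _ _ (g_cont t) (gX_cont _)).
    exact: (cvg_comp _ _ (g_cont t) (gY_cont _)).
  have [|t0 t01 t0min] := @EVT_min R G 0 1 ler01; first exact: continuous_subspaceT.
  exists (G t0); first exact: (C1H_surj_neq0 F_C1H _ (U_surj _ (GU _ (Gg t0)))).
  move=> t; have -> : g t = g (clamp t) by rewrite /g /= (clamp_id (clamp_itv t)).
  by apply: t0min; rewrite in_itv clamp_itv.
have [e e1 he] := vert_arc_sign Gv Hg.
pose o s t := e * hvert (g s) (g t).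
have o_abs s t : `|o s t| = `|hvert (g s) (g t)| by rewrite normrM e1 mul1r.
have hdist_o s t : hdist (g s) (g t) ^+ 2 = `|o s t| by rewrite o_abs; exact: (vert_hdist Gv).
have hdist_o' s t : hdist (g t) (g s) ^+ 2 = `|o s t|.
  by rewrite hdist_o !o_abs hvert_anti normrN.
pose k w := 48 / c * m' (72 * w).
have qadd_o : quasi_additive o k.
  split=> [s|s t u|s t u w].
  - by rewrite /o hvert_diag mulr0.
  - by rewrite !o_abs; apply: hvert_quasi; rewrite -o_abs.
  - move=> st tu; rewrite /o -!mulrBr normrM e1 mul1r.
    rewrite o_abs in st; rewrite o_abs in tu.
    apply: (hvert_defect f_hgrad m'_mono gX_mod gY_mod c0 (c_le t)) => //.
    + by rewrite !GF.
    + by rewrite !GF.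
    + by rewrite -o_abs.
    + by rewrite -o_abs.
have arc_o : quasi_additive_arc o k.
  split=> //.
  - move=> p; apply: cvgM; first exact: cvg_cst.
    exact: (hvert_cont g_cont).
  - by move=> s t; rewrite /o hvert_anti mulrN.
  - move=> s t s0 st t1; rewrite /o /g /= !clamp_id ?he //.
      by rewrite t1 (le_trans s0 (ltW st)).
    by rewrite s0 (le_trans (ltW st)).
have C0 : 0 <= 48 / c by rewrite divr_ge0 // ltW.
(* 288 = 4 * 72, so that [T] sums the terms [k (4 w / 2 ^ j)]. *)
have [T [T_mono T_ge0 T_half T_small]] :=
  dini_tail m'_ge0 m'_mono r_gt1 m'_sum C0 (ler0n R 288).
have gauge : dini_gauge k T.
  split=> //.
  - by move=> s s0; rewrite mulr_ge0 // m'_ge0 // mulr_ge0.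
  - by move=> s t s0 st; apply: ler_wpM2l => //; apply: m'_mono; rewrite ?mulr_ge0 // ler_pM2l.
  - move=> w w0; apply: le_trans (T_half w w0); rewrite lerD2l /k.
    by have -> : 72 * (4 * w) = 288 * w :> R by ring.
move=> eps eps0; have [d d0 hd] := arc_hausdorff2 arc_o gauge hdist_o eps0.
(* [o] is a squared distance, so its threshold [d] becomes a square root for [hdist]. *)
exists (Num.sqrt d); first by rewrite sqrtr_gt0.
move=> C D; rewrite -{1 2}imgE => -[s /= + <-] [t /= + <-].
rewrite !in_itv /= => s01 t01 CD.
rewrite (vert_subarcE Gv Hg) //.
have [a0 b1 ab] : [/\ 0 <= Num.min s t, Num.max s t <= 1 & Num.min s t <= Num.max s t].
  move: s01 t01 => /andP[s0 s1] /andP[t0 t1].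
  by rewrite le_min s0 t0 ge_max s1 t1 le_max ge_min lexx.
have dist_o : hdist (gamma s) (gamma t) ^+ 2 = o (Num.min s t) (Num.max s t).
  rewrite -[RHS](arc_normE arc_o) //.
  have -> : gamma s = g s by rewrite /g /= clamp_id.
  have -> : gamma t = g t by rewrite /g /= clamp_id.
  by case: (leP s t) => _; [exact: hdist_o|exact: hdist_o'].
have -> : gamma @` `[Num.min s t, Num.max s t] = g @` `[Num.min s t, Num.max s t].
  apply: eq_imagel => u /=; rewrite in_itv /= => /andP[u1 u2].
  by rewrite /g /= clamp_id // (le_trans a0) // (le_trans u2).
rewrite dist_o; apply: hd => //; rewrite -dist_o.
rewrite -[ltRHS]sqr_sqrtr ?(ltW d0) // ltrXn2r //.
exact: hrho_ge0.
Qed.
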